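(* One has $$\mathcal J(L^2,a_0,a_1)=a_0+a_1-2\sqrt{a_0a_1}\,\cos_\pi(L),\qquad \cos_\pi(L):=\begin{cases}\cos(L)&\text{for }L<\pi,\\ -1&\text{for }L\ge\pi.\end{cases}$$ The infimum defining $\mathcal J(L^2,a_0,a_1)$ is a minimum for $L<\pi$, and it is attained for $$a(s)=(1-s)^2a_0+s^2a_1+2s(1-s)\sqrt{a_0a_1}\cos(L),$$ $$\rho(s)=\begin{cases}\frac1L\arctan\Big(\frac{s\sin(L)\sqrt{a_1}}{(1-s)\sqrt{a_0}+s\cos(L)\sqrt{a_1}}\Big)&\text{if }(1-s)\sqrt{a_0}+s\cos(L)\sqrt{a_1}>0,\\[1mm] \frac{\pi}{2L}&\text{if }(1-s)\sqrt{a_0}+s\cos(L)\sqrt{a_1}=0,\\[1mm] \frac1L\arctan\Big(\frac{s\sin(L)\sqrt{a_1}}{(1-s)\sqrt{a_0}+s\cos(L)\sqrt{a_1}}\Big)+\frac{\pi}{L}&\text{otherwise.}\end{cases}$$ For $L\ge\pi$ the minimizing sequences converge to $a(s)=c\,(s-\theta)^2$ and $\dot\rho(s)=\delta_\theta(s)$ for certain $c\ge0$ and $\theta\in[0,1]$.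
   Context: The function $\mathcal J:[0,\infty[\times[0,\infty[^2\to[0,\infty[$ is defined, for $L\ge0$ and $a_0,a_1\ge0$, by $$\mathcal J(L^2,a_0,a_1):=\inf\Big\{\int_0^1 \Big(L^2\,\dot\rho(s)^2a(s)+\frac{\dot a(s)^2}{4a(s)}\Big)\,\mathrm ds\ \Big|\ \rho\in\mathfrak R,\ a\in\mathfrak A(a_0,a_1)\Big\},$$ where $\mathfrak R:=\{\rho\in \mathrm H^1(0,1)\mid \rho(0)=0,\ \rho(1)=1,\ \dot\rho\ge0\}$ and $\mathfrak A(a_0,a_1):=\{a\in \mathrm H^1(0,1)\mid a>0,\ a(0)=a_0,\ a(1)=a_1\}$. (This is the infimal squared length of one-mass-point curves $s\mapsto a(s)\delta_{x(s)}$, $x(s)=(1-\rho(s))x_0+\rho(s)x_1$, joining $a_0\delta_{x_0}$ and $a_1\delta_{x_1}$ with $|x_0-x_1|=L$.) A minimizing sequence is a sequence of admissible pairs $(a_n,\rho_n)$ whose integral values converge to the infimum; $\delta_\theta$ is the Dirac mass at $\theta$.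
   Formalization: a>0 is read on ]0,1[. Attainment by the displayed pair is claimed for 0<L<π, a_0,a_1>0, and for L=0, a_0+a_1>0 by the displayed a with any ρ; otherwise for L<π only the integral at the pair equals J. For L≥π, convergence of ρ' to δ_θ assumes a_0+a_1>0. *)

(* Defs.v *)
From HB Require Import structures.
From mathcomp Require Import all_boot all_order all_algebra.
From mathcomp Require Import all_classical all_reals all_analysis.

Set Implicit Arguments.
Unset Strict Implicit.
Unset Printing Implicit Defensive.

Import Order.TTheory GRing.Theory Num.Theory.
Import numFieldNormedType.Exports.

Local Open Scope ring_scope.
Local Open Scope classical_set_scope.

Section Sobolev.
Context {R : realType}.
Implicit Types f g phi : R -> R.

Local Notation mu := (@lebesgue_measure R).
Local Notation I01 := (`]0, 1[%classic : set R).

Definition L2 f : Prop :=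
  measurable_fun I01 f /\ (\int[mu]_(s in I01) (f s ^+ 2)%:E < +oo)%E.

(* The space C^1_c of the open unit interval, by extension by zero to R;
   compactness of the support is automatic, as it is closed and bounded. *)
Definition test_function phi : Prop :=
  [/\ forall s, derivable phi s 1,
      continuous (derive1 phi) &
      closure [set s | phi s != 0] `<=` I01].

(* Testing with C^1_c or with smooth functions gives the same notion, by
   mollification. *)
Definition is_weak_derivative f g : Prop :=
  forall phi, test_function phi ->
    \int[mu]_(s in I01) (f s * derive1 phi s) =
      - \int[mu]_(s in I01) (g s * phi s).

(* Elements of H^1(0,1) are represented by their continuous representatives on
   [0,1], so that boundary values make sense; the values of f outside [0,1] are
   irrelevant. *)
Definition H1 f : Prop :=
  [/\ {within `[0, 1], continuous f}, L2 f &
      exists2 g, L2 g & is_weak_derivative f g].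

(* A chosen square integrable weak derivative; it is unique up to equality
   almost everywhere on (0,1). *)
Definition weak_derivative f : R -> R :=
  xget (cst 0) [set g | L2 g /\ is_weak_derivative f g].

Definition H1_cvg (u : nat -> R -> R) f : Prop :=
  (\int[mu]_(s in I01)
     ((u n s - f s) ^+ 2
      + (weak_derivative (u n) s - weak_derivative f s) ^+ 2)%:E)%E
    @[n --> \oo] --> 0%E.

(* Convergence of the measures g_n(s) ds to the Dirac mass at theta, in duality
   with the continuous functions on the closed interval [0,1]: theta may be an
   endpoint. *)
Definition cvg_to_dirac (g : nat -> R -> R) (theta : R) : Prop :=
  forall phi, {within `[0, 1], continuous phi} ->
    \int[mu]_(s in I01) (phi s * g n s) @[n --> \oo]
      --> \int[\d_theta]_(s in `[0, 1]) phi s.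

End Sobolev.

Section OneMassPoint.
Context {R : realType}.
Implicit Types (rho : R -> R) (Lsq : R).

Local Notation mu := (@lebesgue_measure R).
Local Notation I01 := (`]0, 1[%classic : set R).

Definition admissible_rho rho : Prop :=
  [/\ H1 rho, rho 0 = 0, rho 1 = 1 &
      {ae mu, forall s, I01 s -> 0 <= weak_derivative rho s}].

(* Positivity is required on the open interval only, since a0 and a1 may
   vanish. *)
Definition admissible_a (a0 a1 : R) (a : R -> R) : Prop :=
  [/\ H1 a, forall s, I01 s -> 0 < a s, a 0 = a0 & a 1 = a1].

Definition action Lsq rho (a : R -> R) : \bar R :=
  (\int[mu]_(s in I01)
     (Lsq * weak_derivative rho s ^+ 2 * a s
      + weak_derivative a s ^+ 2 / (4 * a s))%:E)%E.

Definition J Lsq (a0 a1 : R) : \bar R :=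
  ereal_inf [set E | exists rho a,
    [/\ admissible_rho rho, admissible_a a0 a1 a & E = action Lsq rho a]].

Definition minimizer Lsq (a0 a1 : R) rho (a : R -> R) : Prop :=
  [/\ admissible_rho rho, admissible_a a0 a1 a &
      action Lsq rho a = J Lsq a0 a1].

Definition minimizing_sequence Lsq (a0 a1 : R) (rho a : nat -> R -> R) : Prop :=
  [/\ forall n, admissible_rho (rho n), forall n, admissible_a a0 a1 (a n) &
      action Lsq (rho n) (a n) @[n --> \oo] --> J Lsq a0 a1].

Definition cos_pi (L : R) : R := if L < pi then cos L else -1.

Definition a_opt (L a0 a1 s : R) : R :=
  (1 - s) ^+ 2 * a0 + s ^+ 2 * a1
  + 2 * s * (1 - s) * Num.sqrt (a0 * a1) * cos L.

Definition rho_opt (L a0 a1 s : R) : R :=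
  let d := (1 - s) * Num.sqrt a0 + s * cos L * Num.sqrt a1 in
  if 0 < d then L^-1 * atan (s * sin L * Num.sqrt a1 / d)
  else if d == 0 then pi / (2 * L)
  else L^-1 * atan (s * sin L * Num.sqrt a1 / d) + pi / L.

End OneMassPoint.

(* Main.v *)
Require Import Defs.
From mathcomp Require Import all_boot all_order all_algebra.
From mathcomp Require Import all_classical all_reals all_analysis.
From mathcomp Require Import measurable_realfun ring lra.

(** Idea. Put k = min(L, pi) and z = sqrt(a) exp(i k rho) = X + i Y.  Then
    (k rho')^2 a + a'^2 / (4 a) = |z'|^2, so the action is the Dirichlet energy
    of the planar curve z and
      action = |z(1) - z(0)|^2 + int |z' - (z(1) - z(0))|^2,
    which gives the lower bound a0 + a1 - 2 sqrt(a0 a1) cos k.  For L < pi the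
    straight segment from z(0) to z(1), read in polar coordinates, is the
    explicit minimizer.  For L >= pi the segment passes through the apex 0: the
    value is approached by polynomial perturbations of its squared norm, with
    rho jumping on a short interval next to the apex.  Conversely, along a
    minimizing sequence the excess int |z' - (z(1) - z(0))|^2 tends to 0, so z
    converges to the segment in H^1, and
      a' = 2 (X X' + Y Y'),   a k rho' = X Y' - Y X'
    yield the convergence of a and the concentration of rho' at the apex. *)

Set Implicit Arguments.
Unset Strict Implicit.
Unset Printing Implicit Defensive.

Import Order.TTheory GRing.Theory Num.Theory.
Import numFieldNormedType.Exports.

Local Open Scope ring_scope.
Local Open Scope classical_set_scope.

(** * Primitives on the open unit interval *)

(** The obstacle is at the endpoints. When [a0] or [a1] vanishes, the density a' / (2 sqrt(a)) of
    sqrt(a) need not be integrable up to 0 or 1, although [a] lies in H^1. Product and chain rules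
    are therefore proved on compact subintervals of the open interval, where [a] is bounded away
    from 0, by comparing increments with integrals on short intervals. Finite action then makes z'
    square integrable, and continuity of z on the closed interval carries the fundamental theorem of
    calculus to the endpoints. The factor k stops at pi because the action grows with k while -cos k
    is already maximal at pi. Both infima coincide from there on, so a minimizing sequence for L >=
    pi also minimizes for pi. If a0 a1 = 0 and 0 < L < pi, the explicit rho is constant on the open
    interval and violates an endpoint condition, so the value is obtained from the competitors near
    the apex in this case too. *)

Section Primitive.
Context {R : realType}.
Implicit Types (f g h : R -> R) (x y z k e d : R).
Local Notation mu := (@lebesgue_measure R).

Definition loc_integrable01 g := forall x y, 0 < x -> y < 1 ->
  mu.-integrable `[x, y] (EFin \o g).

(* Local absolute continuity on the open interval, with density g.  Nothing is
   required at the endpoints, where the density of sqrt(a) may blow up. *)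
Definition primitive01 f g := loc_integrable01 g /\
  forall x y, 0 < x -> x <= y -> y < 1 ->
    f y - f x = \int[mu]_(r in `[x, y]) g r.

Lemma Rintegral_itv_split g x z y : mu.-integrable `[x, y] (EFin \o g) ->
  x <= z -> z <= y ->
  \int[mu]_(r in `[x, y]) g r
    = \int[mu]_(r in `[x, z]) g r + \int[mu]_(r in `[z, y]) g r.
Proof.
move=> ig xz zy.
have /eqP := @Rintegral_itvB _ _ (BLeft x) (BRight y) z ig xz zy.
have ig' : mu.-integrable `]z, y] (EFin \o g).
  by apply: integrableS ig => //; apply: subset_itvr; rewrite bnd_simp.
by rewrite Rintegral_itv_obnd_cbnd// subr_eq addrC => /eqP.
Qed.

Lemma integrable_itvS g (x y x' y' : R) : mu.-integrable `[x, y] (EFin \o g) ->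
  x <= x' -> y' <= y -> mu.-integrable `[x', y'] (EFin \o g).
Proof.
move=> ig xx yy; apply: integrableS ig => //.
by apply: subset_itv; rewrite bnd_simp.
Qed.

Lemma lebesgue_itv (x y : R) : x <= y -> mu `[x, y]%classic = (y - x)%:E.
Proof.
move=> xy; rewrite lebesgue_measure_itv/= lte_fin -EFinB.
by case: ltP => //= yx; congr (_%:E); apply/esym/eqP; rewrite subr_eq0 eq_le xy yx.
Qed.

Lemma lebesgue_itv_lty (x y : R) : (mu `[x, y]%classic < +oo)%E.
Proof. by rewrite lebesgue_measure_itv/=; case: ifP; rewrite // -EFinB ltry. Qed.

Lemma integrable_itv_cst (x y c : R) : mu.-integrable `[x, y] (EFin \o cst c).
Proof.
apply: measurable_bounded_integrable => //; first exact: lebesgue_itv_lty.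
exact: bounded_cst.
Qed.

Lemma Rintegral_itv_cst (x y c : R) : x <= y ->
  \int[mu]_(r in `[x, y]) c = c * (y - x).
Proof.
by move=> xy; rewrite Rintegral_cst//; congr (_ * _); rewrite [X in fine X]lebesgue_itv.
Qed.

Lemma integrable_itvM g (u : R -> R) (x y M : R) : mu.-integrable `[x, y] (EFin \o g) ->
  measurable_fun `[x, y] u -> (forall r, x <= r <= y -> `|u r| <= M) ->
  mu.-integrable `[x, y] (EFin \o (fun r => u r * g r)).
Proof.
move=> ig mu_ uM.
have := @integrableMr _ _ _ mu `[x, y]%classic _ u _ mu_ _ ig.
apply => //; exists M; split; first by rewrite num_real.
move=> z Mz r /=; rewrite in_itv/= => xry.
by rewrite (le_trans (uM _ xry))// ltW.
Qed.

Lemma ler_Rintegral_itv g h (x y : R) :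
  mu.-integrable `[x, y] (EFin \o g) -> mu.-integrable `[x, y] (EFin \o h) ->
  (forall r, x <= r <= y -> `|g r| <= h r) ->
  `|\int[mu]_(r in `[x, y]) g r| <= \int[mu]_(r in `[x, y]) h r.
Proof.
move=> ig ih gh; apply: (le_trans (le_normr_Rintegral _ ig)) => //.
apply: le_Rintegral => //; first exact: integrable_norm.
Qed.

(** This is absolute continuity of the integral of [g] cut off outside [[x, y]]. The product and
    chain rules below take their moduli [d] from it. *)
Lemma primitive01_unif_cont f g x y : primitive01 f g -> 0 < x -> y < 1 ->
  forall e, 0 < e -> exists2 d, 0 < d & forall r s, x <= r <= y ->
    x <= s <= y -> `|r - s| < d -> `|f r - f s| < e.
Proof.
move=> [ig fg] x0 y1 e e0.
have ixy := ig _ _ x0 y1.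
pose gg := g \_ `[x, y].
have igg : mu.-integrable setT (EFin \o gg).
  by rewrite /gg -restrict_EFin; apply/integrable_restrict => //; rewrite setTI.
have [d [d0 dP]] := integral_normr_continuous igg e0.
exists d => //.
have main r s : x <= r <= y -> x <= s <= y -> r <= s -> s - r < d ->
    `|f s - f r| < e.
  move=> /andP[xr ry] /andP[xs sy] rs rsd.
  rewrite fg//; [|exact: lt_le_trans xr|exact: le_lt_trans y1].
  apply: le_lt_trans (dP `[r, s]%classic _ _) => //.
    apply: le_trans (le_normr_Rintegral _ _) _ => //.
      by apply: integrable_itvS ixy _ _.
    rewrite le_eqVlt; apply/orP; left; apply/eqP/eq_Rintegral => t.
    rewrite inE/= in_itv/= => /andP[rt ts].
    by rewrite /gg patchE mem_set//= in_itv/= (le_trans xr rt) (le_trans ts sy).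
  by rewrite [X in (X < _)%E]lebesgue_itv// lte_fin.
move=> r s xr xs rs; have [rls|/ltW slr] := leP r s.
  by rewrite distrC; apply: main => //; rewrite (le_lt_trans _ rs)// distrC ler_norm.
by apply: main => //; rewrite (le_lt_trans _ rs)// ler_norm.
Qed.

Lemma primitive01_continuous f g x : primitive01 f g -> 0 < x < 1 ->
  {for x, continuous f}.
Proof.
move=> fg /andP[x0 x1]; apply/cvgrPdist_lt => e e0.
have xl : 0 < x / 2 by rewrite divr_gt0.
have xr : (x + 1) / 2 < 1 by lra.
have [d d0 dP] := primitive01_unif_cont fg xl xr e0.
near=> t; apply: dP; first by apply/andP; split; lra.
  suff : t \in `](x / 2), ((x + 1) / 2)[%R by rewrite in_itv/= => /andP[/ltW-> /ltW->].
  near: t; apply: near_in_itvoo; rewrite in_itv/=; apply/andP; split; lra.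
by near: t; apply: cvgr_dist_lt => //; exact: cvg_id.
Unshelve. all: by end_near. Qed.



Lemma primitive01_within f g x y : primitive01 f g -> 0 < x -> y < 1 ->
  {within `[x, y], continuous f}.
Proof.
move=> fg x0 y1; apply: continuous_in_subspaceT => r.
rewrite inE/= in_itv/= => /andP[xr ry].
by apply: primitive01_continuous fg _; rewrite (lt_le_trans x0 xr) (le_lt_trans ry y1).
Qed.

Lemma primitive01_measurable f g x y : primitive01 f g -> 0 < x -> y < 1 ->
  measurable_fun `[x, y] f.
Proof.
move=> fg x0 y1; apply: subspace_continuous_measurable_fun => //.
exact: primitive01_within fg x0 y1.
Qed.

Lemma primitive01_bounded f g x y : primitive01 f g -> 0 < x -> y < 1 ->
  exists M, forall r, x <= r <= y -> `|f r| <= M.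
Proof.
move=> fg x0 y1.
have := continuous_compact (primitive01_within fg x0 y1) (@segment_compact _ x y).
move=> /compact_bounded [M [_ MP]]; exists (M + 1) => r xry.
by apply: (MP (M + 1)); [rewrite ltrDl|exists r => //=; rewrite in_itv].
Qed.

(* The error is additive in the interval and the bound is an integral, so the
   estimate passes from intervals shorter than d to longer ones by halving. *)
Lemma primitive01_local G g h : loc_integrable01 g -> loc_integrable01 h ->
  (forall x y, 0 < x -> y < 1 -> forall e, 0 < e -> exists2 d, 0 < d &
    forall u v, x <= u -> u <= v -> v <= y -> v - u < d ->
      `|G v - G u - \int[mu]_(r in `[u, v]) g r|
        <= e * \int[mu]_(r in `[u, v]) h r) ->
  primitive01 G g.
Proof.
move=> ig ih loc; split => // x y x0 xy y1; apply/eqP; rewrite -subr_eq0.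
set D := _ - _; set H := \int[mu]_(r in `[x, y]) h r.
have key e : 0 < e -> `|D| <= e * H.
  move=> e0; have [d d0 dP] := loc x y x0 y1 e e0.
  have {}dP n : forall u v, x <= u -> u <= v -> v <= y -> v - u < d * 2 ^+ n ->
      `|G v - G u - \int[mu]_(r in `[u, v]) g r| <= e * \int[mu]_(r in `[u, v]) h r.
    elim: n => [|n IH] u v xu uv vy; first by rewrite mulr1; exact: dP.
    rewrite exprS mulrCA => uvd; pose w := (u + v) / 2.
    have [uw wv wu vw] : [/\ u <= w, w <= v, w - u < d * 2 ^+ n & v - w < d * 2 ^+ n].
      by rewrite /w; split; lra.
    have iuv q : loc_integrable01 q -> mu.-integrable `[u, v] (EFin \o q).
      by move=> ik; apply: integrable_itvS (ik _ _ x0 y1) _ _.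
    rewrite (Rintegral_itv_split (iuv _ ig) uw wv).
    rewrite (Rintegral_itv_split (iuv _ ih) uw wv).
    have := IH u w xu uw (le_trans wv vy) wu.
    have := IH w v (le_trans xu uw) wv vy vw.
    set A := \int[mu]_(r in _) _; set B := \int[mu]_(r in _) _.
    set C := \int[mu]_(r in _) _; set E := \int[mu]_(r in _) _.
    move=> h1 h2; rewrite mulrDr.
    rewrite (_ : _ - _ = (G w - G u - C) + (G v - G w - A)); last by ring.
    by rewrite (le_trans (ler_normD _ _))// lerD.
  have [n nP] : exists n, y - x < d * 2 ^+ n.
    pose n := Num.bound ((y - x) / d); exists n.
    rewrite -ltr_pdivrMl// mulrC.
    have := archi_boundP (_ : 0 <= (y - x) / d); rewrite divr_ge0 ?subr_ge0 ?(ltW d0)//.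
    move=> /(_ isT)/lt_trans; apply.
    by rewrite -natrX ltr_nat ltn_expl.
  exact: (dP n).
apply/eqP/normr0_eq0/eqP; rewrite eq_le normr_ge0 andbT leNgt; apply/negP => D0.
have H0 : 0 <= H.
  have := key _ (ltr01); rewrite mul1r; apply: le_trans; exact: ltW.
(* With this [e] the bound [key] makes the norm of [D] at most half of itself; the [+ 1] covers
   [H = 0]. *)
have e0 : 0 < `|D| / (2 * (H + 1)) by rewrite divr_gt0//; lra.
have := key _ e0; rewrite mulrAC ler_pdivlMr; last by lra.
by nra.
Qed.

Lemma loc_integrable01M f f' g : primitive01 f f' -> loc_integrable01 g ->
  loc_integrable01 (fun r => f r * g r).
Proof.
move=> pf ig x y x0 y1; have [M MP] := primitive01_bounded pf x0 y1.
by apply: integrable_itvM (ig _ _ x0 y1) (primitive01_measurable pf x0 y1) MP.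
Qed.

Lemma loc_integrable01D f g : loc_integrable01 f -> loc_integrable01 g ->
  loc_integrable01 (fun r => f r + g r).
Proof.
move=> pf ig x y x0 y1.
rewrite (_ : _ \o _ = (EFin \o f) \+ (EFin \o g))//.
by apply: integrableD (pf _ _ x0 y1) (ig _ _ x0 y1).
Qed.

Lemma loc_integrable01_norm f : loc_integrable01 f ->
  loc_integrable01 (fun r => `|f r|).
Proof.
by move=> pf x y x0 y1; have := integrable_norm (pf _ _ x0 y1).
Qed.

Lemma loc_integrable01Z k f : loc_integrable01 f ->
  loc_integrable01 (fun r => k * f r).
Proof.
move=> pf x y x0 y1.
have := @integrableZl _ _ _ mu `[x, y]%classic _ k _ (pf _ _ x0 y1).
by apply.
Qed.

Lemma loc_integrable01N f : loc_integrable01 f ->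
  loc_integrable01 (fun r => - f r).
Proof.
by move=> /(loc_integrable01Z (-1)) h; under eq_fun do rewrite -mulN1r.
Qed.

Lemma RintegralZl_itv k f u v : mu.-integrable `[u, v] (EFin \o f) ->
  k * \int[mu]_(r in `[u, v]) f r = \int[mu]_(r in `[u, v]) (k * f r).
Proof. by move=> i; rewrite RintegralZl. Qed.

(** With coefficients frozen at [f v] and [g u] the product rule is exact on [[u, v]]. Unfreezing
    them costs at most the oscillations of [f] and [g], which are uniformly small, times the sum of
    the norms of [g'] and [f']. *)
Lemma primitive01M f f' g g' : primitive01 f f' -> primitive01 g g' ->
  primitive01 (fun r => f r * g r) (fun r => f r * g' r + g r * f' r).
Proof.
move=> pf pg; have [if' ff'] := pf; have [ig' gg'] := pg.
have i1 := loc_integrable01M pf ig'; have i2 := loc_integrable01M pg if'.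
apply: (@primitive01_local _ _ (fun r => `|g' r| + `|f' r|)).
- exact: loc_integrable01D.
- by apply: loc_integrable01D; exact: loc_integrable01_norm.
move=> x y x0 y1 e e0.
have [d1 d10 d1P] := primitive01_unif_cont pf x0 y1 e0.
have [d2 d20 d2P] := primitive01_unif_cont pg x0 y1 e0.
exists (Num.min d1 d2); first by rewrite lt_min d10.
move=> u v xu uv vy; rewrite lt_min => /andP[vud1 vud2].
have u0 := lt_le_trans x0 xu; have v1 := le_lt_trans vy y1.
have lf := loc_integrable01Z (f v) ig'; have lg := loc_integrable01Z (g u) if'.
have e1 : f v * g v - f u * g u = \int[mu]_(r in `[u, v]) (f v * g' r + g u * f' r).
  rewrite RintegralD//; [|exact: lf|exact: lg].
  by rewrite -RintegralZl_itv ?(ig' _ _ u0 v1)// -RintegralZl_itv ?(if' _ _ u0 v1)// -ff'// -gg'//; ring.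
rewrite e1 -RintegralB//; last first.
- exact: (loc_integrable01D i1 i2).
- exact: (loc_integrable01D lf lg).
rewrite RintegralZl_itv; last first.
  by apply: (loc_integrable01D (loc_integrable01_norm ig') (loc_integrable01_norm if')).
apply: ler_Rintegral_itv.
- apply: (loc_integrable01D (loc_integrable01D lf lg)) => //.
  by apply: loc_integrable01N; exact: loc_integrable01D.
- by apply: loc_integrable01Z => //; apply: loc_integrable01D; exact: loc_integrable01_norm.
move=> r /andP[ur rv].
rewrite (_ : _ - _ = (f v - f r) * g' r + (g u - g r) * f' r); last by ring.
rewrite mulrDr (le_trans (ler_normD _ _))// !normrM lerD//; apply: ler_wpM2r => //.
  apply/ltW/d1P; first by rewrite vy (le_trans xu uv).
    by rewrite (le_trans xu ur) (le_trans rv vy).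
  by rewrite ger0_norm ?subr_ge0// (le_lt_trans _ vud1)// lerB.
apply/ltW/d2P; first by rewrite xu (le_trans uv vy).
  by rewrite (le_trans xu ur) (le_trans rv vy).
by rewrite distrC ger0_norm ?subr_ge0// (le_lt_trans _ vud2)// lerB.
Qed.

(** The Taylor bound for [F] and the Lipschitz bound for [F'] are asked only along the values of [f]
    on a compact subinterval, with a constant depending on it. This admits the square root of a
    function that vanishes at an endpoint. *)
Lemma primitive01_comp (F F' : R -> R) f f' : primitive01 f f' ->
  (forall x y, 0 < x -> y < 1 -> exists2 K, 0 <= K & forall r s,
    x <= r <= y -> x <= s <= y ->
    `|F (f s) - F (f r) - F' (f r) * (f s - f r)| <= K * (f s - f r) ^+ 2 /\
    `|F' (f s) - F' (f r)| <= K * `|f s - f r|) ->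
  primitive01 (fun r => F (f r)) (fun r => F' (f r) * f' r).
Proof.
move=> pf FP; have [if' ff'] := pf.
have cF' x : 0 < x < 1 -> {for x, continuous (fun r => F' (f r))}.
  move=> /andP[x0 x1]; apply/cvgrPdist_lt => e e0.
  have xl : 0 < x / 2 by rewrite divr_gt0.
  have xr : (x + 1) / 2 < 1 by lra.
  have [K K0 KP] := FP _ _ xl xr.
  have e'0 : 0 < e / (K + 1) by rewrite divr_gt0//; lra.
  have [d d0 dP] := primitive01_unif_cont pf xl xr e'0.
  have xx : x / 2 <= x <= (x + 1) / 2 by apply/andP; split; lra.
  near=> t.
  have tt : x / 2 <= t <= (x + 1) / 2.
    suff : t \in `](x / 2), ((x + 1) / 2)[%R by rewrite in_itv/= => /andP[/ltW-> /ltW->].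
    near: t; apply: near_in_itvoo; rewrite in_itv/=; apply/andP; split; lra.
  have [_ /le_lt_trans] := KP _ _ tt xx; apply.
  have : `|x - t| < d by near: t; apply: cvgr_dist_lt => //; exact: cvg_id.
  move=> /(dP _ _ xx tt); rewrite ltr_pdivlMr; last by lra.
  by have := normr_ge0 (f x - f t); nra.
have iF : loc_integrable01 (fun r => F' (f r) * f' r).
  move=> x y x0 y1.
  have cF : {within `[x, y], continuous (fun r => F' (f r))}.
    apply: continuous_in_subspaceT => r; rewrite inE/= in_itv/= => /andP[xr ry].
    by apply: cF'; rewrite (lt_le_trans x0 xr) (le_lt_trans ry y1).
  have := continuous_compact cF (@segment_compact _ x y).
  move=> /compact_bounded [M [_ MP]].
  apply: (@integrable_itvM _ _ _ _ (M + 1)); first exact: if'.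
    exact: subspace_continuous_measurable_fun.
  move=> r xry.
  by apply: (MP (M + 1)); [rewrite ltrDl|exists r => //=; rewrite in_itv].
apply: (@primitive01_local _ _ (fun r => `|f' r|)) => //.
  exact: loc_integrable01_norm.
move=> x y x0 y1 e e0; have [K K0 KP] := FP _ _ x0 y1.
(* Freezing [F'] at [f u] leaves two errors, the Taylor remainder and the cost of unfreezing. Each
   is at most [K * e' * I], whence the factor 2. *)
have e'0 : 0 < e / (2 * (K + 1)) by rewrite divr_gt0//; lra.
have [d d0 dP] := primitive01_unif_cont pf x0 y1 e'0.
exists d => // u v xu uv vy vud.
have u0 := lt_le_trans x0 xu; have v1 := le_lt_trans vy y1.
have xuy : x <= u <= y by rewrite xu (le_trans uv vy).
have xvy : x <= v <= y by rewrite vy (le_trans xu uv).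
have n1 := loc_integrable01_norm if'.
set e' := e / _ in e'0 dP *; set I := \int[mu]_(r in `[u, v]) `|f' r|.
have I0 : 0 <= I by apply: Rintegral_ge0.
have fI : `|f v - f u| <= I by rewrite ff'//; apply: ler_Rintegral_itv; [exact: if'|exact: n1|].
have lZ := loc_integrable01Z (F' (f u)) if'.
have -> : F (f v) - F (f u) - \int[mu]_(r in `[u, v]) (F' (f r) * f' r) =
    (F (f v) - F (f u) - F' (f u) * (f v - f u)) +
    \int[mu]_(r in `[u, v]) (F' (f u) * f' r - F' (f r) * f' r).
  rewrite RintegralB//; [|exact: lZ|exact: iF].
  by rewrite ff'// RintegralZl_itv; [ring|exact: if'].
have h1 : `|F (f v) - F (f u) - F' (f u) * (f v - f u)| <= K * e' * I.
  have [+ _] := KP _ _ xuy xvy; move/le_trans; apply.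
  rewrite -mulrA ler_wpM2l// -real_normK ?num_real// expr2 ler_pM// ltW//.
  by apply: dP => //; rewrite ger0_norm// subr_ge0.
have h2 : `|\int[mu]_(r in `[u, v]) (F' (f u) * f' r - F' (f r) * f' r)| <= K * e' * I.
  rewrite RintegralZl_itv; last exact: n1.
  apply: ler_Rintegral_itv.
  - by apply: (loc_integrable01D lZ) => //; exact: loc_integrable01N.
  - exact: loc_integrable01Z.
  move=> r /andP[ur rv]; rewrite -mulrBl normrM ler_wpM2r//.
  have xry : x <= r <= y by rewrite (le_trans xu ur) (le_trans rv vy).
  have [_ /le_trans] := KP _ _ xry xuy; apply; rewrite ler_wpM2l// ltW//.
  by apply: dP => //; rewrite distrC ger0_norm ?subr_ge0// (le_lt_trans _ vud)// lerB.
rewrite (le_trans (ler_normD _ _))// (le_trans (lerD h1 h2))//.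
rewrite -mulrDl ler_wpM2r// -mulrDl /e' mulrA ler_pdivrMr; last by lra.
by nra.
Unshelve. all: by end_near. Qed.

End Primitive.

(** * Ramp functions and the du Bois-Reymond lemma *)

Section Ramp.
Context {R : realType}.
Implicit Types (f g : R -> R) (x y z k e d s t h : R).
Local Notation mu := (@lebesgue_measure R).
Local Notation I01 := (`]0, 1[%classic : set R).

(** The functions differentiated through this criterion are polynomials of degree at most two, or
    piecewise so with a continuous derivative; their remainder is explicit and globally
    quadratic. *)
Lemma is_derive_quadratic f x d k :
  (forall h, `|f (x + h) - f x - d * h| <= k * h ^+ 2) -> is_derive x 1 f d.
Proof.
move=> fP.
have k0 : 0 <= k.
  by have := le_trans (normr_ge0 _) (fP 1); rewrite expr1n mulr1.
have cvgd : h^-1 *: ((f \o shift x) h%:A - f x) @[h --> 0^'] --> d.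
  apply/cvgrPdist_lt => e e0; near=> h.
  have h0 : h != 0 by near: h; exact: nbhs_dnbhs_neq.
  have hk : `|h| < e / (k + 1).
    near: h; apply: dnbhs0_lt; rewrite divr_gt0//; lra.
  rewrite /= [h%:A]mulr1 (addrC h) -[_ *: _]/(h^-1 * _).
  rewrite -(ltr_pM2r (_ : 0 < `|h|)) ?normr_gt0// -normrM mulrBl mulrAC mulVf//.
  rewrite mul1r distrC (le_lt_trans (fP h))//.
  rewrite -real_normK ?num_real// expr2 mulrA ltr_pM2r ?normr_gt0//.
  by move: hk; rewrite ltr_pdivlMr; [have := normr_ge0 h; nra|lra].
by apply: DeriveDef; [apply/cvg_ex; exists d|exact/cvg_lim].
Unshelve. all: by end_near. Qed.

(* Second difference of the squared positive part: the simplest C^1 transition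
   from 0 on the left of 0 to 1 on the right of 1. *)
Definition ramp x := 2 * (Num.max x 0 ^+ 2 - 2 * Num.max (x - 2^-1) 0 ^+ 2
  + Num.max (x - 1) 0 ^+ 2).

Definition hat x := 4 * (Num.max x 0 - 2 * Num.max (x - 2^-1) 0
  + Num.max (x - 1) 0).

Let max_quad x k : `|Num.max (x + k) 0 ^+ 2 - Num.max x 0 ^+ 2
    - 2 * Num.max x 0 * k| <= k ^+ 2.
Proof.
rewrite ler_norml; case: (leP (x + k) 0) => h1; case: (leP x 0) => h2;
  apply/andP; split; nra.
Qed.

Lemma is_derive_ramp x : is_derive x 1 ramp (hat x).
Proof.
(* Each squared positive part contributes an error at most [k ^+ 2]; the weights 2, 4 and 2 in
   [ramp] add up to 8. *)
apply: (@is_derive_quadratic _ _ _ 8) => k; rewrite /ramp /hat.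
have := max_quad x k; have := max_quad (x - 2^-1) k; have := max_quad (x - 1) k.
rewrite (addrAC x (- 2^-1)) (addrAC x (- 1)) !ler_norml.
by move=> /andP[? ?] /andP[? ?] /andP[? ?]; apply/andP; split; lra.
Qed.

Lemma continuous_hat : continuous hat.
Proof.
have cm c : continuous (fun x => Num.max (x - c) 0).
  move=> x; have := @continuous_max _ _ (fun x : R => x - c) (cst 0) x.
  apply; last exact: cvg_cst.
  by apply: cvgB; [exact: cvg_id|exact: cvg_cst].
move=> x; apply: cvgM; first exact: cvg_cst.
apply: cvgD; last exact: cm.
apply: cvgB; first by have := cm 0 x; rewrite /continuous_at; under eq_fun do rewrite subr0; rewrite subr0.
by apply: cvgM; [exact: cvg_cst|exact: cm].
Qed.

Lemma ramp_le0 x : x <= 0 -> ramp x = 0.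
Proof.
move=> x0; rewrite /ramp !max_r//; try lra.
Qed.

Lemma ramp_ge1 x : 1 <= x -> ramp x = 1.
Proof.
by move=> x1; rewrite /ramp !max_l; lra.
Qed.

Lemma hat_le0 x : x <= 0 -> hat x = 0.
Proof. by move=> x0; rewrite /hat !max_r//; lra. Qed.

Lemma hat_ge1 x : 1 <= x -> hat x = 0.
Proof. by move=> x1; rewrite /hat !max_l; lra. Qed.

Lemma hat_bound x : 0 <= hat x <= 2.
Proof.
rewrite /hat; case: (leP x 0) => h1; case: (leP (x - 2^-1) 0) => h2;
  case: (leP (x - 1) 0) => h3; apply/andP; split; lra.
Qed.

Lemma ramp_bound x : 0 <= ramp x <= 1.
Proof.
rewrite /ramp; case: (leP x 0) => h1; case: (leP (x - 2^-1) 0) => h2;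
  case: (leP (x - 1) 0) => h3; apply/andP; split; nra.
Qed.

Lemma dist_unit x y : 0 <= x <= 1 -> 0 <= y <= 1 -> `|x - y| <= 1.
Proof.
by move=> /andP[? ?] /andP[? ?]; rewrite ler_norml; apply/andP; split; lra.
Qed.

Definition rampat s e x := ramp ((x - s) / e).
Definition hatat s e x := hat ((x - s) / e) / e.

Lemma is_derive_rampat s e x : is_derive x 1 (rampat s e) (hatat s e x).
Proof.
have h := is_derive_ramp ((x - s) / e).
have h2 : is_derive x 1 (fun x : R => (x - s) / e) e^-1.
  rewrite (_ : (fun _ => _) = (fun x => e^-1 *: (x - s))); last first.
    by apply/funext => y; rewrite mulrC.
  by apply: is_derive_eq; rewrite subr0 /GRing.scale/= mulr1.
have := @is_derive1_comp _ ramp (fun x : R => (x - s) / e) x _ _ h h2.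
by [].
Qed.

Lemma continuous_hatat s e : continuous (hatat s e).
Proof.
move=> x; apply: cvgM; last exact: cvg_cst.
apply: (@continuous_comp _ _ _ (fun x : R => (x - s) / e) hat).
  apply: cvgM; last exact: cvg_cst.
  by apply: cvgB; [exact: cvg_id|exact: cvg_cst].
exact: continuous_hat.
Qed.

Lemma derive1_eq f d x : is_derive x 1 f d -> derive1 f x = d.
Proof. by move=> h; rewrite derive1E derive_val. Qed.

Lemma rampat_le s e x : 0 < e -> x <= s -> rampat s e x = 0.
Proof.
by move=> e0 xs; apply: ramp_le0; rewrite pmulr_lle0 ?invr_gt0// subr_le0.
Qed.

Lemma rampat_ge s e x : 0 < e -> s + e <= x -> rampat s e x = 1.
Proof. by move=> e0 xs; apply: ramp_ge1; rewrite ler_pdivlMr// mul1r; lra. Qed.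

Lemma hatat_le s e x : 0 < e -> x <= s -> hatat s e x = 0.
Proof.
by move=> e0 xs; rewrite /hatat hat_le0 ?mul0r// pmulr_lle0 ?invr_gt0// subr_le0.
Qed.

Lemma hatat_ge s e x : 0 < e -> s + e <= x -> hatat s e x = 0.
Proof. by move=> e0 xs; rewrite /hatat hat_ge1 ?mul0r// ler_pdivlMr// mul1r; lra. Qed.

Lemma hatat_bound s e x : 0 < e -> 0 <= hatat s e x <= 2 / e.
Proof.
move=> e0; have /andP[h0 h2] := hat_bound ((x - s) / e).
by rewrite /hatat divr_ge0 ?(ltW e0)//= ler_pM2r ?invr_gt0.
Qed.

Lemma integral_hatat s e : 0 < e -> \int[mu]_(r in `[s, s + e]) hatat s e r = 1.
Proof.
move=> e0; rewrite /Rintegral.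
rewrite (@continuous_FTC2 _ _ (rampat s e)); first last.
- by move=> r _; exact: derive1_eq (is_derive_rampat _ _ _).
- have c x : {for x, continuous (rampat s e)}.
    apply: differentiable_continuous; apply/derivable1_diffP.
    exact: (@ex_derive _ _ _ _ _ _ _ (is_derive_rampat s e x)).
  split; [|apply: cvg_at_right_filter; exact: c|apply: cvg_at_left_filter; exact: c].
  by move=> r _; exact: (@ex_derive _ _ _ _ _ _ _ (is_derive_rampat s e r)).
- by apply: continuous_subspaceT => r; exact: continuous_hatat.
- by rewrite ltrDl.
by rewrite rampat_ge// rampat_le//= subr0.
Qed.

Lemma Rintegral_support (D E : set R) f : measurable D -> measurable E ->
  E `<=` D -> (forall x, D x -> ~ E x -> f x = 0) ->
  mu.-integrable E (EFin \o f) ->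
  mu.-integrable D (EFin \o f) /\
  \int[mu]_(x in D) f x = \int[mu]_(x in E) f x.
Proof.
move=> mD mE ED f0 iE.
have DE : D `&` E = E by apply/setIidPr.
have eqf x : D x -> (f \_ E) x = f x.
  move=> Dx; rewrite patchE; case: ifPn => //; rewrite notin_setE => nE.
  by rewrite f0.
split.
  have : mu.-integrable D ((EFin \o f) \_ E).
    by apply/integrable_restrict => //; rewrite DE.
  apply: eq_integrable => // x; rewrite inE => Dx.
  by rewrite restrict_EFin /= eqf.
rewrite -[in RHS]DE Rintegral_mkcondr; apply: eq_Rintegral => x; rewrite inE => Dx.
by rewrite eqf.
Qed.

Lemma integrable_cont (x y : R) f : {within `[x, y], continuous f} ->
  mu.-integrable `[x, y] (EFin \o f).
Proof. by move=> cf; apply: continuous_compact_integrable => //; exact: segment_compact. Qed.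

Lemma within_mul (A : set R) f g : {within A, continuous f} -> {within A, continuous g} ->
  {within A, continuous (fun x => f x * g x)}.
Proof. by move=> cf cg x; apply: cvgM; [exact: cf|exact: cg]. Qed.

Lemma I01_within f x y : (forall r, I01 r -> {for r, continuous f}) ->
  0 < x -> y < 1 -> {within `[x, y], continuous f}.
Proof.
move=> cf x0 y1; apply: continuous_in_subspaceT => r.
rewrite inE/= in_itv/= => /andP[xr ry]; apply: cf.
by rewrite /= in_itv/= (lt_le_trans x0 xr) (le_lt_trans ry y1).
Qed.

Lemma itv_sub01 x y : 0 < x -> y < 1 -> `[x, y] `<=` I01.
Proof. by move=> x0 y1; apply: subset_itv; rewrite bnd_simp. Qed.

(** [hatat s e] is a probability density on [[s, s + e]], so the integral is an average of [f] near
    [s]. This turns the identity for test functions into one for point values. *)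
Lemma hatat_average f s e d : (forall r, I01 r -> {for r, continuous f}) ->
  0 < s -> 0 < e -> s + e < 1 ->
  (forall r, s <= r <= s + e -> `|f r - f s| <= d) ->
  mu.-integrable I01 (EFin \o (fun r => f r * hatat s e r)) /\
  `|\int[mu]_(r in I01) (f r * hatat s e r) - f s| <= d.
Proof.
move=> cf s0 e0 se1 fd.
have cw := I01_within cf s0 se1.
have ch : {within `[s, s + e], continuous (hatat s e)}.
  by apply: continuous_subspaceT => r; exact: continuous_hatat.
have i1 := integrable_cont (within_mul cw ch).
have [i2 ->] : mu.-integrable I01 (EFin \o (fun r => f r * hatat s e r)) /\
    \int[mu]_(r in I01) (f r * hatat s e r) =
    \int[mu]_(r in `[s, s + e]) (f r * hatat s e r).
  apply: Rintegral_support => //; first exact: itv_sub01.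
  move=> r _ /=; rewrite in_itv/= => /negP; rewrite negb_and -!ltNge => /orP[rs|rs].
    by rewrite hatat_le ?mulr0// ltW.
  by rewrite hatat_ge ?mulr0// ltW.
split => //.
have ih := integrable_cont ch.
have ich k : mu.-integrable `[s, s + e] (EFin \o (fun r => k * hatat s e r)).
  by apply: integrable_cont; apply: within_mul => // r; exact: cvg_cst.
rewrite -[X in _ - X]mulr1 -(integral_hatat s e0) RintegralZl_itv//.
rewrite -RintegralB//.
rewrite (_ : d = \int[mu]_(r in `[s, s + e]) (d * hatat s e r)); last first.
  by rewrite -RintegralZl_itv// integral_hatat// mulr1.
apply: ler_Rintegral_itv => //.
  have mi : measurable (`[s, s + e]%classic : set R) by [].
  by have := @integrableB _ _ _ mu _ mi _ _ i1 (ich (f s)); apply.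
move=> r sr; rewrite -mulrBl normrM.
have /andP[h0 _] := hatat_bound s r e0.
by rewrite (ger0_norm h0) ler_wpM2r// fd.
Qed.

Lemma I01_lty : (mu I01 < +oo)%E.
Proof. by rewrite lebesgue_measure_itv/= lte_fin ltr01 -EFinB ltry. Qed.

Lemma mu_I01 : mu I01 = 1%E.
Proof. by rewrite lebesgue_measure_itv/= lte_fin ltr01 -EFinB subr0. Qed.

Lemma L2_measurable f : L2 f -> measurable_fun I01 f.
Proof. by case. Qed.

Lemma L2_integrable_sqr f : L2 f -> mu.-integrable I01 (EFin \o (fun r => f r ^+ 2)).
Proof.
move=> [mf f2]; apply/integrableP; split.
  by apply/measurable_EFinP; exact: measurable_funX.
by under eq_integral => x _ do rewrite /= ger0_norm ?sqr_ge0//.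
Qed.

Lemma integrable_I01_cst k : mu.-integrable I01 (EFin \o cst k).
Proof.
apply: measurable_bounded_integrable => //; first exact: I01_lty.
exact: bounded_cst.
Qed.

Lemma integrable_I01D f g : mu.-integrable I01 (EFin \o f) ->
  mu.-integrable I01 (EFin \o g) ->
  mu.-integrable I01 (EFin \o (fun r => f r + g r)).
Proof.
move=> fi gi; have mi : measurable I01 by [].
by have := @integrableD _ _ _ mu _ mi _ _ fi gi; apply.
Qed.

Lemma integrable_I01Z k f : mu.-integrable I01 (EFin \o f) ->
  mu.-integrable I01 (EFin \o (fun r => k * f r)).
Proof.
move=> fi; have mi : measurable I01 by [].
by have := @integrableZl _ _ _ mu _ mi k _ fi; apply.
Qed.

Lemma integrable_I01B f g : mu.-integrable I01 (EFin \o f) ->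
  mu.-integrable I01 (EFin \o g) ->
  mu.-integrable I01 (EFin \o (fun r => f r - g r)).
Proof.
move=> fi gi; have mi : measurable I01 by [].
by have := @integrableB _ _ _ mu _ mi _ _ fi gi; apply.
Qed.

Lemma integrable_I01_le f g : measurable_fun I01 f ->
  (forall r, I01 r -> `|f r| <= g r) -> mu.-integrable I01 (EFin \o g) ->
  mu.-integrable I01 (EFin \o f).
Proof.
move=> mf fg gi; apply: le_integrable gi => //; first exact/measurable_EFinP.
by move=> r r01; rewrite /= lee_fin (le_trans (fg _ r01))// ler_norm.
Qed.

Lemma L2_integrable f : L2 f -> mu.-integrable I01 (EFin \o f).
Proof.
move=> f2; have := integrable_I01D (integrable_I01_cst 1) (L2_integrable_sqr f2).
apply: integrable_I01_le; first exact: L2_measurable.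
move=> r _ /=; rewrite ler_norml; apply/andP; split; nra.
Qed.

Lemma integrable_I01_loc g : mu.-integrable I01 (EFin \o g) -> loc_integrable01 g.
Proof.
by move=> ig x y x0 y1; apply: integrableS ig => //; exact: itv_sub01.
Qed.

Lemma test_function_bump s t e : 0 < s -> s <= t -> 0 < e -> t + e < 1 ->
  test_function (fun x => rampat s e x - rampat t e x) /\
  derive1 (fun x => rampat s e x - rampat t e x) =
    (fun x => hatat s e x - hatat t e x).
Proof.
move=> s0 st e0 te1.
have d x : is_derive x 1 (fun x => rampat s e x - rampat t e x)
    (hatat s e x - hatat t e x).
  by have := is_deriveB (is_derive_rampat s e x) (is_derive_rampat t e x).
have e1 : derive1 (fun x => rampat s e x - rampat t e x) =
    (fun x => hatat s e x - hatat t e x).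
  by apply/funext => x; exact: derive1_eq.
split => //; split.
- by move=> x; exact: (@ex_derive _ _ _ _ _ _ _ (d x)).
- by rewrite e1 => x; apply: cvgB; exact: continuous_hatat.
have sub : [set x | rampat s e x - rampat t e x != 0] `<=` `[s, t + e].
  move=> x /=; rewrite in_itv/= => x0.
  rewrite leNgt [X in _ && X]leNgt -negb_or; apply: contra x0 => /orP[xs|xt].
    by rewrite !rampat_le// ?subrr// ltW// (lt_le_trans xs).
  by rewrite !rampat_ge// ?subrr// ltW// (le_lt_trans _ xt)// lerD2r.
apply: subset_trans (itv_sub01 s0 te1).
have cl : closed (`[s, t + e]%classic : set R) by exact: itv_closed.
by rewrite ((closure_id _).1 cl); exact: closureS.
Qed.

(* The test functions are C^1 approximations of the indicator of [s, t]. *)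
Lemma weak_derivative_primitive f g : (forall r, I01 r -> {for r, continuous f}) ->
  mu.-integrable I01 (EFin \o g) -> is_weak_derivative f g -> primitive01 f g.
Proof.
move=> cf ig fg; have lg := integrable_I01_loc ig.
split => // s t s0; rewrite le_eqVlt => /predU1P[<- _|st t1].
  by rewrite subrr set_itv1 Rintegral_set1.
apply/eqP; rewrite -subr_eq0; apply/eqP/normr0_eq0/eqP.
rewrite eq_le normr_ge0 andbT; apply/ler_addgt0Pr => d0 d00; rewrite add0r.
(* Four errors of size [d] will appear: the averages of [f] at [s] and at [t], and the integrals of
   [g] over the two transition zones. *)
pose d := d0 / 4; have d_gt0 : 0 < d by rewrite divr_gt0.
have igg : mu.-integrable setT (EFin \o (g \_ I01)).
  by rewrite -restrict_EFin; apply/integrable_restrict => //; rewrite setTI.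
have [e1 [e10 e1P]] := integral_normr_continuous igg d_gt0.
have near_cont x : 0 < x < 1 -> exists2 e, 0 < e & forall r,
    `|r - x| <= e -> `|f r - f x| <= d.
  move=> x01; have /cvgrPdist_le/(_ d d_gt0)/nbhs_ballP[e /= e0 eP] := cf x x01.
  exists (e / 2); first by rewrite divr_gt0.
  move=> r rx; rewrite distrC; apply: eP; rewrite /ball/= distrC.
  by rewrite (le_lt_trans rx)// gtr_pMr// invf_lt1// ltr1n.
have s1 := lt_trans st t1; have t0 := lt_trans s0 st.
have [e2 e20 e2P] := near_cont s (introT andP (conj s0 s1)).
have [e3 e30 e3P] := near_cont t (introT andP (conj t0 t1)).
(* The first entry controls integrals of [g] over length [e], the next two the oscillation of [f] at
   [s] and [t]. The last two keep the bump inside the interval and its two ramps disjoint. *)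
pose e := Num.min (Num.min (e1 / 2) e2) (Num.min e3 (Num.min ((1 - t) / 2) (t - s))).
have [e0 ee1 ee2 ee3] : [/\ 0 < e, e < e1, e <= e2 & e <= e3].
  have h : e <= e1 / 2 by rewrite /e !ge_min lexx.
  split; [|by rewrite (le_lt_trans h)//; lra|by rewrite /e !ge_min lexx !orbT|
    by rewrite /e !ge_min lexx !orbT].
  rewrite /e !lt_min e20 e30/= !divr_gt0 ?subr_gt0//.
have [ee4 ee5] : e <= (1 - t) / 2 /\ e <= t - s.
  by rewrite /e !ge_min !lexx !orbT.
have te1 : t + e < 1 by lra.
have se1 : s + e < 1 by lra.
have [tphi dphi] := test_function_bump s0 (ltW st) e0 te1.
have := fg _ tphi; rewrite dphi.
have [|is_ As] := @hatat_average f s e d cf s0 e0 se1.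
  move=> r /andP[sr re]; apply: e2P.
  by rewrite ger0_norm ?subr_ge0// lerBlDl (le_trans re)// lerD2l.
have [|it_ At] := @hatat_average f t e d cf t0 e0 te1.
  move=> r /andP[sr re]; apply: e3P.
  by rewrite ger0_norm ?subr_ge0// lerBlDl (le_trans re)// lerD2l.
under eq_Rintegral do rewrite mulrBr.
rewrite RintegralB//.
set Is := \int[mu]_(r in _) _ in As *; set It := \int[mu]_(r in _) _ in At *.
set phi := fun x => _ in tphi dphi *.
have cphi : continuous phi.
  case: tphi => + _ _ => dr x; apply: differentiable_continuous.
  exact/derivable1_diffP.
have phib r : `|phi r| <= 1.
  by apply: dist_unit; exact: ramp_bound.
have ip x y : 0 < x -> y < 1 -> mu.-integrable `[x, y] (EFin \o (fun r => g r * phi r)).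
  move=> x0 y1; rewrite (_ : (fun r => _) = (fun r => phi r * g r)); last first.
    by apply/funext => r; rewrite mulrC.
  apply: (@integrable_itvM _ _ phi _ _ 1); [exact: lg|exact: measurable_funTS (continuous_measurable_fun cphi)|].
  by move=> r _; exact: phib.
have [_ ->] : mu.-integrable I01 (EFin \o (fun r => g r * phi r)) /\
    \int[mu]_(r in I01) (g r * phi r) =
    \int[mu]_(r in `[s, t + e]) (g r * phi r).
  apply: Rintegral_support => //; first exact: itv_sub01.
    move=> r _ /=; rewrite in_itv/= => /negP; rewrite negb_and -!ltNge => /orP[rs|rs].
      by rewrite /phi !rampat_le ?subrr ?mulr0// ltW// (lt_trans rs).
    by rewrite /phi !rampat_ge ?subrr ?mulr0// ltW// (le_lt_trans _ rs)// lerD2r ltW.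
  exact: ip.
have se_t : s + e <= t by rewrite addrC -lerBrDr.
rewrite (@Rintegral_itv_split _ (fun r => g r * phi r) s (s + e) (t + e)); first last.
- by rewrite lerD2r ltW.
- by rewrite lerDl ltW.
- exact: ip.
rewrite (@Rintegral_itv_split _ (fun r => g r * phi r) (s + e) t (t + e)); first last.
- by rewrite lerDl ltW.
- exact: se_t.
- by apply: ip => //; rewrite addr_gt0.
rewrite (@Rintegral_itv_split _ g s (s + e) t); first last.
- exact: se_t.
- by rewrite lerDl ltW.
- exact: lg.
have small x (h : R -> R) : 0 < x -> x + e < 1 -> (forall r, `|h r| <= `|g r|) ->
    mu.-integrable `[x, x + e] (EFin \o h) ->
    `|\int[mu]_(r in `[x, x + e]) h r| <= d.
  move=> x0 xe1 hg ih; apply: (@le_trans _ _ (\int[mu]_(r in `[x, x + e]) `|g r|)).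
    by apply: ler_Rintegral_itv => //; exact: integrable_norm (lg _ _ x0 xe1).
  apply/ltW; apply: le_lt_trans (e1P `[x, x + e]%classic _ _) => //.
    rewrite le_eqVlt; apply/orP; left; apply/eqP/eq_Rintegral => r; rewrite inE => rx.
    by rewrite patchE mem_set//; exact: (itv_sub01 x0 xe1).
  by rewrite [X in (X < _)%E]lebesgue_itv ?lerDl ?ltW// lte_fin addrC addKr.
have a1 : `|\int[mu]_(r in `[s, s + e]) (g r * phi r - g r)| <= d.
  apply: small => //.
    move=> r; rewrite -[X in _ - X]mulr1 -mulrBr normrM ler_piMr//.
    have one01 : 0 <= (1 : R) <= 1 by rewrite ler01 lexx.
    rewrite /phi; have [rt|rt] := leP r t.
      by rewrite (rampat_le e0 rt) subr0; apply: dist_unit => //; exact: ramp_bound.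
    rewrite (rampat_ge e0 (le_trans se_t (ltW rt))) addrAC subrr add0r normrN.
    by rewrite -[X in `|X|]subr0; apply: dist_unit; rewrite ?lexx ?ler01//; exact: ramp_bound.
  have mi : measurable (`[s, s + e]%classic : set R) by [].
  by have := @integrableB _ _ _ mu _ mi _ _ (ip _ _ s0 se1) (lg _ _ s0 se1); apply.
have a2 : `|\int[mu]_(r in `[t, t + e]) (g r * phi r)| <= d.
  apply: small => //; last exact: ip.
  by move=> r; rewrite normrM ler_piMr.
have a3 : \int[mu]_(r in `[s + e, t]) (g r * phi r) = \int[mu]_(r in `[s + e, t]) g r.
  apply: eq_Rintegral => r; rewrite inE/= in_itv/= => /andP[ser rt].
  by rewrite /phi (rampat_ge e0 ser) (rampat_le e0 rt) subr0 mulr1.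
rewrite a3.
move: a1; rewrite RintegralB//; [|exact: ip|exact: lg].
move: As At a2; rewrite !ler_norml.
move=> /andP[l1 u1] /andP[l2 u2] /andP[l3 u3] /andP[l4 u4] E.
have dd : d * 4 = d0 by rewrite /d mulrC mulrA mulrAC divff ?mul1r.
clearbody d Is It; clear -l1 u1 l2 u2 l3 u3 l4 u4 E dd.
by apply/andP; split; lra.
Qed.

End Ramp.

(** * Weak derivatives *)

Section WeakDerivative.
Context {R : realType}.
Implicit Types (f g : R -> R) (x y z k e d s t h : R).
Local Notation mu := (@lebesgue_measure R).
Local Notation I01 := (`]0, 1[%classic : set R).

Lemma test_functionP phi : test_function phi ->
  continuous phi /\ exists s t, [/\ 0 < s, s < t, t < 1 &
    forall x, ~ (s <= x <= t) -> phi x = 0 /\ derive1 phi x = 0].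
Proof.
move=> [dphi cphi' cl]; split.
  by move=> x; apply: differentiable_continuous; apply/derivable1_diffP.
have zero_near x : ~ I01 x -> \forall y \near x, phi y = 0.
  move=> nx; have ncl : ~ closure [set s | phi s != 0] x by move=> /cl.
  have : nbhs x (~` closure [set s | phi s != 0]).
    by apply: open_nbhs_nbhs; split => //; exact/closed_openC/closed_closure.
  apply: filterS => y; apply: contra_notP => /eqP yn.
  exact: subset_closure.
have /nbhs_ballP[e /= e0 eP] : \forall y \near (0 : R), phi y = 0.
  by apply: zero_near; rewrite /= in_itv/= ltxx.
have /nbhs_ballP[d /= d0 dP] : \forall y \near (1 : R), phi y = 0.
  by apply: zero_near; rewrite /= in_itv/= ltxx andbF.
(* Capping both margins at 1/4 guarantees [s < t]. *)
pose s := Num.min (e / 2) (1 / 4); pose t := 1 - Num.min (d / 2) (1 / 4).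
have [s0 se s4] : [/\ 0 < s, s <= e / 2 & s <= 1 / 4].
  by rewrite lt_min !divr_gt0//= !ge_min !lexx ?orbT.
have [t0 td t4] : [/\ t < 1, 1 - d / 2 <= t & 1 - 1 / 4 <= t].
  rewrite /t lerB ?ge_min ?lexx// lerB ?ge_min ?lexx ?orbT//.
  by split => //; rewrite gtrBl lt_min !divr_gt0.
exists s, t; split => //; first by lra.
move=> x /negP; rewrite negb_and -!ltNge => xst.
have near0 : \forall y \near x, phi y = 0.
  have [nx|nx] := pselect (I01 x); last exact: zero_near.
  move: nx; rewrite /= in_itv/= => /andP[x0 x1].
  case/orP: xst => [xs|tx].
    have : \forall y \near x, y \in `]0, s[%R.
      by apply: near_in_itvoo; rewrite in_itv/= x0.
    apply: filterS => y; rewrite in_itv/= => /andP[y0 ys].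
    apply: eP; rewrite /ball/= sub0r normrN gtr0_norm//; lra.
  have : \forall y \near x, y \in `]t, 1[%R.
    by apply: near_in_itvoo; rewrite in_itv/= tx.
  apply: filterS => y; rewrite in_itv/= => /andP[yt y1].
  apply: dP; rewrite /ball/= gtr0_norm//; lra.
split; first exact: nbhs_singleton near0.
rewrite derive1E; have <- : 'D_1 (cst 0 : R -> R) x = 0 by exact: derive_cst.
by apply: near_eq_derive; exact: near0.
Qed.

Lemma Rintegral_I01_support f s t : 0 < s -> t < 1 ->
  (forall x, ~ (s <= x <= t) -> f x = 0) ->
  mu.-integrable `[s, t] (EFin \o f) ->
  mu.-integrable I01 (EFin \o f) /\
  \int[mu]_(x in I01) f x = \int[mu]_(x in `[s, t]) f x.
Proof.
move=> s0 t1 f0 ifs; apply: Rintegral_support => //; first exact: itv_sub01.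
by move=> x _ /=; rewrite in_itv/= => /f0.
Qed.

Lemma integrable_mul_test g phi : mu.-integrable I01 (EFin \o g) ->
  test_function phi -> mu.-integrable I01 (EFin \o (fun x => g x * phi x)).
Proof.
move=> ig /test_functionP[cphi [s [t [s0 st t1 phi0]]]].
have ist : mu.-integrable `[s, t] (EFin \o g) by exact: integrable_I01_loc.
have := continuous_compact (continuous_subspaceT cphi) (@segment_compact _ s t).
move=> /compact_bounded [M [_ MP]].
have i2 : mu.-integrable `[s, t] (EFin \o (fun x => g x * phi x)).
  rewrite (_ : (fun x => _) = (fun r => phi r * g r)); last first.
    by apply/funext => r; rewrite mulrC.
  apply: (@integrable_itvM _ _ phi _ _ (M + 1)) => //.
    exact: measurable_funTS (continuous_measurable_fun cphi).
  move=> r rst; by apply: (MP (M + 1)); [rewrite ltrDl|exists r => //=; rewrite in_itv].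
have [] // := Rintegral_I01_support s0 t1 _ i2.
by move=> x /phi0[-> _]; rewrite mulr0.
Qed.

(** By Lebesgue differentiation, [h] is almost everywhere the derivative of its indefinite integral,
    which is constant on the open interval. *)
Lemma primitive01_0_ae (h : R -> R) : mu.-integrable I01 (EFin \o h) ->
  primitive01 (cst 0) h -> {ae mu, forall x, I01 x -> h x = 0}.
Proof.
move=> ih [lh ph].
pose h0 := h \_ I01.
have ih0 : mu.-integrable setT (EFin \o h0).
  by rewrite /h0 -restrict_EFin; apply/integrable_restrict => //; rewrite setTI.
have loc : locally_integrable [set: R] h0 by apply: integrable_locally.
have int y : mu.-integrable [set` Interval (BRight 0) (BRight y)] (EFin \o h0).
  by apply: integrableS ih0.
have := FTC1 int loc => /=; apply: filterS; first exact: (ae_filter_ringOfSetsType mu).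
move=> x + x01; move: (x01); rewrite /= in_itv/= => /andP[x0 x1].
move=> /(_ x0)[_ F'x].
have hx : h0 x = h x by rewrite /h0 patchE mem_set.
rewrite -hx -F'x.
set F := fun y => _.
have Fc : \forall y \near x, F y = F x.
  have : \forall y \near x, y \in `]0, 1[%R by apply: near_in_itvoo; rewrite in_itv/= x0.
  have main (u v : R) : 0 < u -> u <= v -> v < 1 -> F v = F u.
    move=> u0 uv v1; apply/eqP; rewrite -subr_eq0 /F.
    rewrite (Rintegral_itvB (int v)) ?bnd_simp ?(ltW u0)//.
    have iu : mu.-integrable `]u, v] (EFin \o h0) by exact: integrableS ih0.
    rewrite Rintegral_itv_obnd_cbnd//.
    apply/eqP; transitivity (\int[mu]_(r in `[u, v]) h r); last by rewrite -ph// subrr.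
    apply: eq_Rintegral => r; rewrite inE => ruv; rewrite /h0 patchE mem_set//.
    exact: (itv_sub01 u0 v1).
  apply: filterS => y; rewrite in_itv/= => /andP[y0 y1].
  by have [xy|/ltW yx] := leP x y; [exact: main|apply/esym; exact: main].
rewrite derive1E; have <- : 'D_1 (cst (F x) : R -> R) x = 0 by exact: derive_cst.
by apply: near_eq_derive; exact: Fc.
Qed.

Lemma C1_weak_derivative f g : (forall x, I01 x -> is_derive x 1 f (g x)) ->
  (forall x, I01 x -> {for x, continuous g}) -> is_weak_derivative f g.
Proof.
move=> df cg phi tphi; have [cphi [s [t [s0 st t1 phi0]]]] := test_functionP tphi.
have [dphi cphi' _] := tphi.
have cf x : I01 x -> {for x, continuous f}.
  move=> x01; apply: differentiable_continuous; apply/derivable1_diffP.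
  exact: (@ex_derive _ _ _ _ _ _ _ (df x x01)).
have wf := I01_within cf; have wg := I01_within cg.
have wphi x y : {within `[x, y], continuous phi} by exact: continuous_subspaceT.
have wphi' x y : {within `[x, y], continuous (derive1 phi)} by exact: continuous_subspaceT.
(* Integration by parts is done on a slightly larger interval, at whose ends [phi] is known to
   vanish, so the boundary terms drop out. *)
pose s' := s / 2; pose t' := (t + 1) / 2.
have [s'0 ss' tt' t'1 st'] : [/\ 0 < s', s' < s, t < t', t' < 1 & s' < t'].
  by rewrite /s' /t'; split; lra.
have sub x : ~ (s' <= x <= t') -> ~ (s <= x <= t).
  by apply: contra_not => /andP[sx xt]; rewrite (le_trans (ltW ss') sx) (le_trans xt (ltW tt')).
have [||_ ->] := @Rintegral_I01_support (fun x => f x * derive1 phi x) s' t' s'0 t'1.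
- by move=> x /sub/phi0[_ ->]; rewrite mulr0.
- exact: (integrable_cont (within_mul (wf _ _ s'0 t'1) (wphi' _ _))).
have [||_ ->] := @Rintegral_I01_support (fun x => g x * phi x) s' t' s'0 t'1.
- by move=> x /sub/phi0[-> _]; rewrite mulr0.
- exact: (integrable_cont (within_mul (wg _ _ s'0 t'1) (wphi _ _))).
have p1 : phi s' = 0.
  by have [] := phi0 s' _ => //; move=> /andP[+ _]; rewrite leNgt ss'.
have p2 : phi t' = 0.
  by have [] := phi0 t' _ => //; move=> /andP[_]; rewrite leNgt tt'.
rewrite (@Rintegration_by_parts _ f phi g (derive1 phi) s' t' st').
- by rewrite p1 p2 !mulr0 subrr sub0r.
- exact: wg.
- have s'I : I01 s' by rewrite /= in_itv/= s'0 (lt_trans st').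
  have t'I : I01 t' by rewrite /= in_itv/= t'1 (lt_trans s'0).
  split.
  + move=> x; rewrite in_itv/= => /andP[xs xt].
    apply: (@ex_derive _ _ _ _ _ _ _ (df x _)).
    by rewrite /= in_itv/= (lt_trans s'0 xs) (lt_trans xt t'1).
  + by apply: cvg_at_right_filter; exact: cf.
  + by apply: cvg_at_left_filter; exact: cf.
- move=> x; rewrite in_itv/= => /andP[xs xt].
  apply: derive1_eq; apply: df.
  by rewrite /= in_itv/= (lt_trans s'0 xs) (lt_trans xt t'1).
- exact: wphi'.
- split; [by []|apply: cvg_at_right_filter; exact: cphi|
    apply: cvg_at_left_filter; exact: cphi].
- by [].
Qed.

(** The difference of the two is a weak derivative of 0, hence the density of a constant, hence zero
    almost everywhere. *)
Lemma is_weak_derivative_unique_ae f g1 g2 : mu.-integrable I01 (EFin \o g1) ->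
  mu.-integrable I01 (EFin \o g2) ->
  is_weak_derivative f g1 -> is_weak_derivative f g2 ->
  {ae mu, forall x, I01 x -> g1 x = g2 x}.
Proof.
move=> i1 i2 w1 w2.
have i12 := integrable_I01B i1 i2.
have : {ae mu, forall x, I01 x -> g1 x - g2 x = 0}.
  apply: primitive01_0_ae => //; apply: weak_derivative_primitive => //.
    by move=> r _; exact: cvg_cst.
  move=> phi tphi; have /= := w2 _ tphi; rewrite w1// => /oppr_inj e12.
  under eq_Rintegral do rewrite mul0r.
  rewrite Rintegral_cst// mul0r.
  under eq_Rintegral do rewrite mulrBl.
  rewrite RintegralB//; [|exact: integrable_mul_test|exact: integrable_mul_test].
  by rewrite e12 subrr oppr0.
apply: filterS; first exact: (ae_filter_ringOfSetsType mu).
by move=> x hx /hx /eqP; rewrite subr_eq0 => /eqP.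
Qed.

Lemma weak_derivativeP f g : L2 g -> is_weak_derivative f g ->
  L2 (weak_derivative f) /\ is_weak_derivative f (weak_derivative f).
Proof.
by move=> g2 fg; exact: (@xgetPex _ (cst 0) [set g | L2 g /\ is_weak_derivative f g]
  (ex_intro _ g (conj g2 fg))).
Qed.

Lemma weak_derivative_ae f g : L2 g -> is_weak_derivative f g ->
  {ae mu, forall x, I01 x -> weak_derivative f x = g x}.
Proof.
move=> g2 fg; have [w2 fw] := weak_derivativeP g2 fg.
by apply: (is_weak_derivative_unique_ae _ _ fw fg); exact: L2_integrable.
Qed.

(** Both sides choose from the same set, so the equality is literal and not just almost everywhere.
    It serves for functions with a wrong value at an endpoint, such as [rho_opt] when
    [a0 * a1 = 0]. *)
Lemma weak_derivative_eq f g : (forall x, I01 x -> f x = g x) ->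
  weak_derivative f = weak_derivative g.
Proof.
move=> fg; rewrite /weak_derivative; congr xget; apply/seteqP.
have main (u v : R -> R) : (forall x, I01 x -> u x = v x) ->
    forall w, is_weak_derivative u w -> is_weak_derivative v w.
  move=> uv w uw phi tphi; rewrite -uw//; apply: eq_Rintegral => x; rewrite inE => xI.
  by rewrite uv.
split => w /= [w2 ww]; split => //; first exact: main fg _ ww.
by apply: main ww => x /fg.
Qed.

Lemma within_L2 f : {within `[0, 1], continuous f} -> L2 f.
Proof.
move=> cf; split.
  have mc : measurable_fun (`[0, 1]%classic : set R) f.
    exact: subspace_continuous_measurable_fun.
  by apply: measurable_funS mc => //; apply: subset_itv; rewrite bnd_simp.
have ic := integrable_cont (within_mul cf cf).
have : mu.-integrable I01 (EFin \o (fun x => f x * f x)).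
  by apply: integrableS ic => //; apply: subset_itv; rewrite bnd_simp.
move=> /integrableP[_]; apply: le_lt_trans.
by rewrite le_eqVlt; apply/orP; left; apply/eqP/eq_integral => x _; rewrite /= expr2 ger0_norm// -expr2 sqr_ge0.
Qed.

Lemma C1_H1 f g : {within `[0, 1], continuous f} -> {within `[0, 1], continuous g} ->
  (forall x, I01 x -> is_derive x 1 f (g x)) -> H1 f.
Proof.
move=> cf cg fg; split => //; first exact: within_L2.
exists g; first exact: within_L2.
apply: C1_weak_derivative => // x x01.
by have /(continuous_within_itvP _ ltr01)[+ _ _] := cg; exact.
Qed.

Lemma C1_weak_derivative_ae f g : {within `[0, 1], continuous g} ->
  (forall x, I01 x -> is_derive x 1 f (g x)) ->
  {ae mu, forall x, I01 x -> weak_derivative f x = g x}.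
Proof.
move=> cg fg; apply: weak_derivative_ae; first exact: within_L2.
apply: C1_weak_derivative => // x x01.
by have /(continuous_within_itvP _ ltr01)[+ _ _] := cg; exact.
Qed.

Lemma H1_L2_weak_derivative f : H1 f -> L2 (weak_derivative f).
Proof. by move=> [_ _ [g g2 fg]]; have [] := weak_derivativeP g2 fg. Qed.

Lemma H1_primitive f : H1 f -> primitive01 f (weak_derivative f).
Proof.
move=> [cf _ [g g2 fg]]; have [w2 fw] := weak_derivativeP g2 fg.
apply: weak_derivative_primitive => //; last exact: L2_integrable.
by move=> r r01; have /(continuous_within_itvP _ ltr01)[+ _ _] := cf; exact.
Qed.

Lemma integrable_I01_cc g : mu.-integrable I01 (EFin \o g) ->
  mu.-integrable `[0, 1] (EFin \o g).
Proof.
move=> /integrableP[mg gi]; apply/integrableP; split.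
  apply/emeasurable_fun_itv_obnd_cbndP/emeasurable_fun_itv_bndo_bndcP.
  exact: mg.
rewrite -integral_itv_obnd_cbnd; last first.
  apply: measurableT_comp => //.
  exact/emeasurable_fun_itv_bndo_bndcP.
rewrite -integral_itv_bndo_bndc//.
exact: measurableT_comp.
Qed.

Lemma Rintegral_I01_cc g : mu.-integrable I01 (EFin \o g) ->
  \int[mu]_(r in `[0, 1]) g r = \int[mu]_(r in I01) g r.
Proof.
move=> ig; have ic := integrable_I01_cc ig.
rewrite -Rintegral_itv_obnd_cbnd; last first.
  by apply: integrableS ic => //; apply: subset_itvr; rewrite bnd_simp.
by rewrite -Rintegral_itv_bndo_bndc.
Qed.

(** The difference of [f] and the integral of [g] from 0 is continuous on the closed interval and
    constant on the open one. This is the passage from the local calculus to boundary values. *)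
Lemma primitive01_cc f g : {within `[0, 1], continuous f} ->
  mu.-integrable I01 (EFin \o g) -> primitive01 f g ->
  forall x, 0 <= x -> x <= 1 -> f x - f 0 = \int[mu]_(r in `[0, x]) g r.
Proof.
move=> cf ig [_ fg].
have ic := integrable_I01_cc ig.
have cp := parameterized_integral_continuous ler01 ic.
pose d x := f x - parameterized_integral mu 0 x g.
have cd : {within `[0, 1], continuous d}.
  by move=> x; apply: cvgB; [exact: cf|exact: cp].
have /(continuous_within_itvP _ ltr01)[_ d0 d1] := cd.
have dc x : 0 < x < 1 -> d x = d (2^-1).
  have main (u v : R) : 0 < u -> u <= v -> v < 1 -> d v = d u.
    move=> u0 uv v1; rewrite /d /parameterized_integral.
    rewrite (@Rintegral_itv_split _ g 0 u v)//; last 2 first.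
    - by apply: integrable_itvS ic _ (ltW v1).
    - exact: ltW.
    by rewrite -(fg u v)//; ring.
  move=> /andP[x0 x1]; have [h|/ltW h] := leP x 2^-1; last by apply: main => //; lra.
  by apply/esym/main => //; lra.
have e0 : d 0 = d 2^-1.
  apply: (@cvg_unique _ (@Rhausdorff R) _ _ _ _ d0).
  apply: cvg_near_cst; near=> y; apply: dc; apply/andP; split; near: y.
    exact: nbhs_right_gt.
  exact: nbhs_right_lt.
have e1 : d 1 = d 2^-1.
  apply: (@cvg_unique _ (@Rhausdorff R) _ _ _ _ d1).
  apply: cvg_near_cst; near=> y; apply: dc; apply/andP; split; near: y.
    exact: nbhs_left_gt.
  exact: nbhs_left_lt.
have d0f : d 0 = f 0 by rewrite /d /parameterized_integral set_itv1 Rintegral_set1 subr0.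
move=> x x0 x1; have : d x = f 0.
  rewrite -d0f; move: x0 x1; rewrite !le_eqVlt => /predU1P[<-//|x0] /predU1P[->|x1].
    by rewrite e1 e0.
  by rewrite e0 dc// x0.
by rewrite /d /parameterized_integral => <-; ring.
Unshelve. all: by end_near. Qed.

End WeakDerivative.

(** * Chain rules *)

Section Taylor.
Context {R : realType}.
Implicit Types (f g : R -> R) (x y z k e d s t r h : R).

Lemma MVT_sym f df r s : (forall x, is_derive x 1 f (df x)) ->
  exists2 z, `|z - r| <= `|s - r| & f s - f r = df z * (s - r).
Proof.
move=> fdf.
have cf x y : {within `[x, y], continuous f}.
  apply: continuous_subspaceT => z; apply: differentiable_continuous.
  by apply/derivable1_diffP; exact: (@ex_derive _ _ _ _ _ _ _ (fdf z)).
have [rs|/ltW sr] := leP r s.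
  have [z] := MVT_segment rs (fun x _ => fdf x) (cf r s).
  rewrite in_itv/= => /andP[rz zs] E; exists z => //.
  by rewrite !ger0_norm ?subr_ge0// lerB.
have [z] := MVT_segment sr (fun x _ => fdf x) (cf s r).
rewrite in_itv/= => /andP[sz zr] E; exists z; last by rewrite -opprB E -mulrN opprB.
by rewrite !ler0_norm ?subr_le0// lerN2 lerB.
Qed.

Lemma lipschitz_derive f df r s : (forall x, is_derive x 1 f (df x)) ->
  (forall x, `|df x| <= 1) -> `|f s - f r| <= `|s - r|.
Proof.
by move=> fdf df1; have [z _ ->] := MVT_sym r s fdf; rewrite normrM ler_piMl.
Qed.

Lemma taylor2 f df r s : (forall x, is_derive x 1 f (df x)) ->
  (forall x y, `|df y - df x| <= `|y - x|) ->
  `|f s - f r - df r * (s - r)| <= (s - r) ^+ 2.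
Proof.
move=> fdf df1; have [z zr ->] := MVT_sym r s fdf.
rewrite -mulrBl normrM -[leRHS]real_normK ?num_real// expr2 ler_wpM2r//.
exact: le_trans (df1 _ _) zr.
Qed.

Lemma normr_sin_le1 x : `|sin x : R| <= 1.
Proof. by rewrite ler_norml sin_geN1 sin_le1. Qed.

Lemma normr_cos_le1 x : `|cos x : R| <= 1.
Proof. by rewrite ler_norml cos_geN1 cos_le1. Qed.

Lemma lipschitz_sin r s : `|sin s - sin r : R| <= `|s - r|.
Proof. by apply: (@lipschitz_derive _ cos) => // x; exact: normr_cos_le1. Qed.

Lemma lipschitz_cos r s : `|cos s - cos r : R| <= `|s - r|.
Proof.
by apply: (@lipschitz_derive _ (fun x => - sin x)) => // x; rewrite normrN; exact: normr_sin_le1.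
Qed.

Lemma primitive01_cos f g : primitive01 f g ->
  primitive01 (fun r => cos (f r)) (fun r => - sin (f r) * g r).
Proof.
move=> fg; apply: (@primitive01_comp _ cos (fun x => - sin x)) => // x y _ _.
exists 1 => // r s _ _; rewrite !mul1r; split.
  apply: (@taylor2 _ (fun x => - sin x)) => u v.
  by rewrite opprK addrC distrC; exact: lipschitz_sin.
by rewrite opprK addrC distrC; exact: lipschitz_sin.
Qed.

Lemma primitive01_sin f g : primitive01 f g ->
  primitive01 (fun r => sin (f r)) (fun r => cos (f r) * g r).
Proof.
move=> fg; apply: (@primitive01_comp _ sin cos) => // x y _ _.
exists 1 => // r s _ _; rewrite !mul1r; split; last exact: lipschitz_cos.
by apply: taylor2 => u v; exact: lipschitz_cos.
Qed.

(** With p = u^2 and q = v^2 the remainder is exactly -(v - u)^2 / (2 u), and q - p = (v - u) (v +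
    u). Bounding u and v below by sqrt(m) yields the constant. *)
Lemma sqrt_taylor (m p q : R) : 0 < m -> m <= p -> m <= q ->
  `|Num.sqrt q - Num.sqrt p - (2 * Num.sqrt p)^-1 * (q - p)|
     <= (m * Num.sqrt m)^-1 * (q - p) ^+ 2 /\
  `|(2 * Num.sqrt q)^-1 - (2 * Num.sqrt p)^-1| <= (m * Num.sqrt m)^-1 * `|q - p|.
Proof.
move=> m0 mp mq.
have n0 : 0 < Num.sqrt m by rewrite sqrtr_gt0.
have np : Num.sqrt m <= Num.sqrt p by rewrite ler_wsqrtr.
have nq : Num.sqrt m <= Num.sqrt q by rewrite ler_wsqrtr.
have em : m = Num.sqrt m ^+ 2 by rewrite sqr_sqrtr// ltW.
have ep : p = Num.sqrt p ^+ 2 by rewrite sqr_sqrtr// (le_trans (ltW m0)).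
have eq : q = Num.sqrt q ^+ 2 by rewrite sqr_sqrtr// (le_trans (ltW m0)).
move: n0 np nq em ep eq; set n := Num.sqrt m; set u := Num.sqrt p; set v := Num.sqrt q.
move=> n0 nu nv -> -> ->.
have u0 : 0 < u by lra.
have v0 : 0 < v by lra.
have uvn : 2 * n <= u + v by lra.
have h3 : 0 < n ^+ 2 * n by rewrite mulr_gt0// exprn_gt0.
split.
  rewrite (_ : v - u - _ = - ((v - u) ^+ 2 / (2 * u))); last by field; lra.
  rewrite normrN ger0_norm ?divr_ge0 ?sqr_ge0//; last by lra.
  rewrite [leRHS]mulrC ler_pdivrMr ?mulr_gt0// mulrAC ler_pdivlMr//.
  have e : v ^+ 2 - u ^+ 2 = (v - u) * (v + u) by ring.
  rewrite e exprMn.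
  have : n ^+ 2 * n <= (v + u) ^+ 2 * (2 * u).
    have : n ^+ 2 <= (v + u) ^+ 2 by rewrite lerXn2r ?nnegrE; lra.
    by move=> ?; apply: ler_pM => //; [exact: sqr_ge0|lra|lra].
  by rewrite -(mulrA ((v - u) ^+ 2)) => ?; apply: ler_wpM2l => //; exact: sqr_ge0.
rewrite (_ : _ - _ = (u - v) / (2 * u * v)); last by field; lra.
rewrite (_ : v ^+ 2 - u ^+ 2 = - ((u - v) * (u + v))); last by ring.
rewrite normrN !normrM normfV (ger0_norm (_ : 0 <= u + v)); last by lra.
have uv0 : 0 < 2 * u * v by rewrite !mulr_gt0.
rewrite (gtr0_norm uv0).
have key : (2 * u * v)^-1 <= (n ^+ 2 * n)^-1 * (u + v).
  rewrite [leRHS]mulrC ler_pdivlMr// mulrC ler_pdivrMr//.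
  have : n * n <= u * v by apply: ler_pM; lra.
  move=> nuv; have : n * n * n <= u * v * (u + v) by apply: ler_pM; nra.
  by nra.
have /le_trans := ler_wpM2l (normr_ge0 (u - v)) key; apply.
by rewrite mulrCA.
Qed.

Lemma primitive01_sqrt f g : primitive01 f g -> (forall r, 0 < r < 1 -> 0 < f r) ->
  primitive01 (fun r => Num.sqrt (f r)) (fun r => (2 * Num.sqrt (f r))^-1 * g r).
Proof.
move=> fg f0; apply: (@primitive01_comp _ Num.sqrt (fun x => (2 * Num.sqrt x)^-1)) => //.
move=> x y x0 y1; have [xy|yx] := leP x y; last first.
  exists 0 => // r s /andP[xr ry]; have := le_lt_trans (le_trans xr ry) yx.
  by rewrite ltxx.
(* The minimum of [f] over the compact subinterval is positive and plays the part of [m] in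
   [sqrt_taylor]. It may tend to 0 as the subinterval grows. *)
have [c cxy cmin] := EVT_min xy (primitive01_within fg x0 y1).
have m0 : 0 < f c.
  move: cxy; rewrite in_itv/= => /andP[xc cy].
  by apply: f0; rewrite (lt_le_trans x0 xc) (le_lt_trans cy y1).
exists (f c * Num.sqrt (f c))^-1; first by rewrite invr_ge0 mulr_ge0 ?sqrtr_ge0// ltW.
by move=> r s xr xs; apply: sqrt_taylor => //; apply: cmin; rewrite in_itv.
Qed.

End Taylor.

(** * Variance and the energy excess over affine interpolation *)

Section Square.
Context {R : realType}.
Implicit Types (f g X dX : R -> R) (x y z k e d s t r h : R).
Local Notation mu := (@lebesgue_measure R).
Local Notation I01 := (`]0, 1[%classic : set R).

Lemma Rintegral_I01_cst k : \int[mu]_(r in I01) k = k.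
Proof. by rewrite Rintegral_cst// [X in fine X]mu_I01 mulr1. Qed.

Lemma L2_intro f : measurable_fun I01 f ->
  mu.-integrable I01 (EFin \o (fun r => f r ^+ 2)) -> L2 f.
Proof.
move=> mf /integrableP[_] h; split => //; apply: le_lt_trans h.
rewrite le_eqVlt; apply/orP; left; apply/eqP/eq_integral => x _.
by rewrite /= ger0_norm// sqr_ge0.
Qed.

Lemma L2_le f g : measurable_fun I01 f -> mu.-integrable I01 (EFin \o g) ->
  (forall r, I01 r -> f r ^+ 2 <= g r) -> L2 f.
Proof.
move=> mf ig fg; apply: L2_intro => //; apply: integrable_I01_le ig.
  exact: measurable_funX.
by move=> r r01; rewrite ger0_norm ?sqr_ge0// fg.
Qed.

Lemma L2_cst k : L2 (cst k : R -> R).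
Proof. by apply: within_L2 => x; exact: cvg_cst. Qed.


Lemma L2D f g : L2 f -> L2 g -> L2 (fun r => f r + g r).
Proof.
move=> f2 g2; apply: (L2_le _ (integrable_I01Z 2 (integrable_I01D
  (L2_integrable_sqr f2) (L2_integrable_sqr g2)))).
  by apply: measurable_funD; exact: L2_measurable.
by move=> r _ /=; have := sqr_ge0 (f r - g r); nra.
Qed.

Lemma L2N f : L2 f -> L2 (fun r => - f r).
Proof.
move=> f2; apply: (L2_le _ (L2_integrable_sqr f2)).
  by apply: measurableT_comp => //; exact: L2_measurable.
by move=> r _; rewrite sqrrN.
Qed.

Lemma L2B f g : L2 f -> L2 g -> L2 (fun r => f r - g r).
Proof. by move=> f2 g2; apply: L2D => //; exact: L2N. Qed.

Lemma L2_norm f : L2 f -> L2 (fun r => `|f r|).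
Proof.
move=> f2; apply: (L2_le _ (L2_integrable_sqr f2)).
  by apply: measurableT_comp => //; exact: L2_measurable.
by move=> r _; rewrite real_normK ?num_real.
Qed.

Lemma Rintegral_variance f k : L2 f ->
  \int[mu]_(r in I01) (f r - k) ^+ 2
  = \int[mu]_(r in I01) f r ^+ 2 - 2 * k * \int[mu]_(r in I01) f r + k ^+ 2.
Proof.
move=> f2; have i1 := L2_integrable f2; have i2 := L2_integrable_sqr f2.
have i3 := integrable_I01Z (2 * k) i1.
rewrite -[in RHS](Rintegral_I01_cst (k ^+ 2)).
rewrite -(@RintegralZl _ _ _ mu _ _ (2 * k))// -RintegralB// -RintegralD//.
- by apply: eq_Rintegral => r _; ring.
- exact: integrable_I01B.
- exact: integrable_I01_cst.
Qed.

(** Lebesgue measure on the unit interval is a probability measure, and the variance of [f] is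
    nonnegative. *)
Lemma sqr_Rintegral_le f : L2 f ->
  (\int[mu]_(r in I01) f r) ^+ 2 <= \int[mu]_(r in I01) f r ^+ 2.
Proof.
move=> f2; have := Rintegral_variance (\int[mu]_(r in I01) f r) f2.
have : 0 <= \int[mu]_(r in I01) (f r - \int[mu]_(r in I01) f r) ^+ 2.
  by apply: Rintegral_ge0 => x _; exact: sqr_ge0.
move: (\int[mu]_(r in I01) (_ - _) ^+ 2) => V.
move: (\int[mu]_(r in I01) f r ^+ 2) (\int[mu]_(r in I01) f r) => W m.
by move=> V0 E; rewrite E in V0; nra.
Qed.

Lemma Rintegral_sub_le f s : mu.-integrable I01 (EFin \o f) -> 0 <= s -> s <= 1 ->
  `|\int[mu]_(r in `[0, s]) f r| <= \int[mu]_(r in I01) `|f r|.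
Proof.
move=> fi s0 s1; have ic := integrable_I01_cc fi.
have icn := integrable_norm ic.
rewrite -Rintegral_I01_cc; last exact: (integrable_norm fi).
rewrite (@Rintegral_itv_split _ (fun r => `|f r|) 0 s 1)//.
apply: (@le_trans _ _ (\int[mu]_(r in `[0, s]) `|f r|)).
  by apply: le_normr_Rintegral => //; exact: integrable_itvS ic _ _.
by rewrite lerDl; apply: Rintegral_ge0.
Qed.

Variables (X dX : R -> R).
Hypotheses (cX : {within `[0, 1], continuous X}) (dX2 : L2 dX) (pX : primitive01 X dX).

(** The mean of [dX] is [X 1 - X 0], so this is the splitting of a second moment into squared mean
    and variance. *)
Lemma excess_eq : \int[mu]_(r in I01) dX r ^+ 2 =
  (X 1 - X 0) ^+ 2 + \int[mu]_(r in I01) (dX r - (X 1 - X 0)) ^+ 2.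
Proof.
rewrite Rintegral_variance// (primitive01_cc cX (L2_integrable dX2) pX)//.
by rewrite Rintegral_I01_cc; [ring|exact: L2_integrable].
Qed.

(** The deviation from the affine interpolant at [s] is the integral over [[0, s]] of the centred
    density; by Cauchy-Schwarz the energy excess controls it uniformly in [s]. *)
Lemma excess_dev s : 0 <= s -> s <= 1 ->
  (X s - (X 0 + s * (X 1 - X 0))) ^+ 2
    <= \int[mu]_(r in I01) (dX r - (X 1 - X 0)) ^+ 2.
Proof.
move=> s0 s1; set A := X 1 - X 0.
have dA := L2B dX2 (L2_cst A).
have iX := L2_integrable dX2.
have -> : X s - (X 0 + s * A) = \int[mu]_(r in `[0, s]) (dX r - A).
  have i1 := integrable_itvS (integrable_I01_cc iX) (lexx 0) s1.
  rewrite RintegralB//; last exact: integrable_itv_cst.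
  rewrite -(primitive01_cc cX iX pX)// Rintegral_itv_cst// subr0; ring.
have h := Rintegral_sub_le (L2_integrable dA) s0 s1.
apply: (@le_trans _ _ ((\int[mu]_(r in I01) `|dX r - A|) ^+ 2)).
  have h0 : 0 <= \int[mu]_(r in I01) `|dX r - A| by apply: Rintegral_ge0.
  by rewrite -[leLHS]real_normK ?num_real// lerXn2r ?nnegrE.
apply: (le_trans (sqr_Rintegral_le (L2_norm dA))).
rewrite le_eqVlt; apply/orP; left; apply/eqP/eq_Rintegral => r _.
by rewrite real_normK ?num_real.
Qed.

End Square.

(** * The cone over the line *)

Section Cone.
Context {R : realType}.
Implicit Types (f g a rho : R -> R) (L l x y z k e d s t r h : R).
Local Notation mu := (@lebesgue_measure R).
Local Notation I01 := (`]0, 1[%classic : set R).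

Definition coneX k rho a s := Num.sqrt (a s) * cos (k * rho s).
Definition coneY k rho a s := Num.sqrt (a s) * sin (k * rho s).
(* Radial and angular speed: coneP is the derivative of sqrt(a), and coneQ is
   sqrt(a) times the derivative of the angle. *)
Definition coneP a s := (2 * Num.sqrt (a s))^-1 * weak_derivative a s.
Definition coneQ k rho a s := Num.sqrt (a s) * (k * weak_derivative rho s).
Definition coneX' k rho a s :=
  coneP a s * cos (k * rho s) - coneQ k rho a s * sin (k * rho s).
Definition coneY' k rho a s :=
  coneP a s * sin (k * rho s) + coneQ k rho a s * cos (k * rho s).

Lemma I01_P x : I01 x = (0 < x < 1) :> Prop.
Proof. by rewrite /= in_itv. Qed.

Lemma primitive01Z k f g : primitive01 f g ->
  primitive01 (fun r => k * f r) (fun r => k * g r).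
Proof.
move=> [ig fg]; split; first exact: loc_integrable01Z.
by move=> x y x0 xy y1; rewrite -mulrBr fg// RintegralZl_itv//; exact: ig.
Qed.


Section Lift.
Variables (k : R) (rho a : R -> R).
Hypotheses (H1rho : H1 rho) (H1a : H1 a) (a_gt0 : forall s, I01 s -> 0 < a s).

Let krho := primitive01Z k (H1_primitive H1rho).

Let pb : primitive01 (fun s => Num.sqrt (a s)) (coneP a).
Proof. by apply: (primitive01_sqrt (H1_primitive H1a)) => r r01; exact: a_gt0. Qed.

Lemma coneX_primitive : primitive01 (coneX k rho a) (coneX' k rho a).
Proof.
have := primitive01M pb (primitive01_cos krho).
by congr primitive01; apply/funext => s; rewrite /coneX' /coneQ; ring.
Qed.

Lemma coneY_primitive : primitive01 (coneY k rho a) (coneY' k rho a).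
Proof.
have := primitive01M pb (primitive01_sin krho).
by congr primitive01; apply/funext => s; rewrite /coneY' /coneQ; ring.
Qed.

Let within_comp (F : R -> R) f : continuous F -> {within `[0, 1], continuous f} ->
  {within `[0, 1], continuous (fun s => F (f s))}.
Proof.
by move=> cF cf x; apply: (@continuous_comp _ _ _ (f : subspace _ -> R) F); [exact: cf|exact: cF].
Qed.

Let csqrt : {within `[0, 1], continuous (fun s => Num.sqrt (a s))}.
Proof. by case: H1a => ca _ _; apply: within_comp => //; exact: sqrt_continuous. Qed.

Let ckrho : {within `[0, 1], continuous (fun s => k * rho s)}.
Proof.
case: H1rho => ca _ _; apply: (@within_comp ( *%R k)) => //.
exact: mulrl_continuous.
Qed.

Lemma coneX_continuous : {within `[0, 1], continuous coneX k rho a}.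
Proof. by apply: within_mul => //; apply: within_comp => //; exact: continuous_cos. Qed.

Lemma coneY_continuous : {within `[0, 1], continuous coneY k rho a}.
Proof. by apply: within_mul => //; apply: within_comp => //; exact: continuous_sin. Qed.

Lemma cone_sqr s : I01 s -> a s = coneX k rho a s ^+ 2 + coneY k rho a s ^+ 2.
Proof.
move=> s01; rewrite /coneX /coneY !exprMn -mulrDr cos2Dsin2 mulr1 sqr_sqrtr//.
by rewrite ltW// a_gt0.
Qed.

(** This and the next two identities hold at every point and not just almost everywhere: [coneX']
    and [coneY'] are algebraic expressions in the chosen weak derivatives. *)
Lemma cone_radial s : I01 s -> weak_derivative a s =
  2 * (coneX k rho a s * coneX' k rho a s + coneY k rho a s * coneY' k rho a s).
Proof.
move=> s01; have n0 : Num.sqrt (a s) != 0 by rewrite gt_eqF// sqrtr_gt0 a_gt0.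
have E : weak_derivative a s = 2 * Num.sqrt (a s) * coneP a s.
  by rewrite /coneP; field.
rewrite {1}E /coneX /coneX' /coneY /coneY'.
have := cos2Dsin2 (k * rho s).
move: (coneP a s) (coneQ k rho a s) (cos _) (sin _) (Num.sqrt _) => p q c S b cs.
have -> : 2 * (b * c * (p * c - q * S) + b * S * (p * S + q * c))
  = 2 * b * p * (c ^+ 2 + S ^+ 2) by ring.
by rewrite cs mulr1.
Qed.

Lemma cone_angular s : I01 s -> a s * (k * weak_derivative rho s) =
  coneX k rho a s * coneY' k rho a s - coneY k rho a s * coneX' k rho a s.
Proof.
move=> s01.
have E : a s * (k * weak_derivative rho s) = Num.sqrt (a s) * coneQ k rho a s.
  by rewrite /coneQ [in RHS]mulrA -expr2 sqr_sqrtr// ltW// a_gt0.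
rewrite E /coneX /coneX' /coneY /coneY'.
have := cos2Dsin2 (k * rho s).
move: (coneP a s) (coneQ k rho a s) (cos _) (sin _) (Num.sqrt _) => p q c S b cs.
have -> : b * c * (p * S + q * c) - b * S * (p * c - q * S)
  = b * q * (c ^+ 2 + S ^+ 2) by ring.
by rewrite cs mulr1.
Qed.

Lemma cone_action_density s : I01 s ->
  k ^+ 2 * weak_derivative rho s ^+ 2 * a s + weak_derivative a s ^+ 2 / (4 * a s)
  = coneX' k rho a s ^+ 2 + coneY' k rho a s ^+ 2.
Proof.
move=> s01; have n0 : Num.sqrt (a s) != 0 by rewrite gt_eqF// sqrtr_gt0 a_gt0.
have E : k ^+ 2 * weak_derivative rho s ^+ 2 * a s + weak_derivative a s ^+ 2 / (4 * a s)
  = coneP a s ^+ 2 + coneQ k rho a s ^+ 2.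
  rewrite /coneP /coneQ -{1 2}[a s]sqr_sqrtr ?(ltW (a_gt0 s01))//.
  by field.
rewrite E /coneX' /coneY'; have := cos2Dsin2 (k * rho s).
move: (coneP a s) (coneQ k rho a s) (cos _) (sin _) => p q c S cs.
have -> : (p * c - q * S) ^+ 2 + (p * S + q * c) ^+ 2
  = (p ^+ 2 + q ^+ 2) * (c ^+ 2 + S ^+ 2) by ring.
by rewrite cs mulr1.
Qed.

Let measurable_within f : {within `[0, 1], continuous f} -> measurable_fun I01 f.
Proof. by move=> /within_L2 []. Qed.

Let mP : measurable_fun I01 (coneP a).
Proof.
apply: measurable_funM; last exact: L2_measurable (H1_L2_weak_derivative H1a).
apply: open_continuous_measurable_fun; first exact: interval_open.
move=> x; rewrite inE => x01.
have n0 : 2 * Num.sqrt (a x) != 0 by rewrite mulf_neq0// gt_eqF// sqrtr_gt0 a_gt0.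
apply: (@continuousV _ _ (fun x => 2 * Num.sqrt (a x))) => //.
apply: cvgM; first exact: cvg_cst.
by have /(continuous_within_itvP _ ltr01)[+ _ _] := csqrt; apply.
Qed.

Let mQ : measurable_fun I01 (coneQ k rho a).
Proof.
apply: measurable_funM; first exact: measurable_within.
apply: measurable_funM => //.
exact: L2_measurable (H1_L2_weak_derivative H1rho).
Qed.

Let mcos : measurable_fun I01 (fun s => cos (k * rho s)).
Proof. by apply: measurable_within; apply: within_comp => //; exact: continuous_cos. Qed.

Let msin : measurable_fun I01 (fun s => sin (k * rho s)).
Proof. by apply: measurable_within; apply: within_comp => //; exact: continuous_sin. Qed.

Lemma coneX'_measurable : measurable_fun I01 (coneX' k rho a).
Proof. by apply: measurable_funB; apply: measurable_funM. Qed.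

Lemma coneY'_measurable : measurable_fun I01 (coneY' k rho a).
Proof. by apply: measurable_funD; apply: measurable_funM. Qed.

Lemma action_cone : action (k ^+ 2) rho a =
  (\int[mu]_(s in I01) (coneX' k rho a s ^+ 2 + coneY' k rho a s ^+ 2)%:E)%E.
Proof.
by apply: eq_integral => s; rewrite inE => s01; rewrite cone_action_density.
Qed.

Hypothesis fin_action : (action (k ^+ 2) rho a < +oo)%E.

Let isqr : mu.-integrable I01
  (EFin \o (fun s => coneX' k rho a s ^+ 2 + coneY' k rho a s ^+ 2)).
Proof.
apply/integrableP; split.
  apply/measurable_EFinP; apply: measurable_funD; apply: measurable_funX.
    exact: coneX'_measurable.
  exact: coneY'_measurable.
have := fin_action; rewrite action_cone.
under [X in _ -> (X < _)%E] eq_integral => s _.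
  rewrite /= ger0_norm; last by rewrite addr_ge0// sqr_ge0.
  over.
by [].
Qed.

(** Finiteness of the action is essential: for [a] in H^1 with a zero at an endpoint, [coneP a] can
    fail to be square integrable there. *)
Lemma coneX'_L2 : L2 (coneX' k rho a).
Proof.
apply: (L2_le coneX'_measurable isqr) => r _.
by rewrite lerDl sqr_ge0.
Qed.

Lemma coneY'_L2 : L2 (coneY' k rho a).
Proof.
apply: (L2_le coneY'_measurable isqr) => r _.
by rewrite lerDr sqr_ge0.
Qed.

Definition excessX k rho a := \int[mu]_(r in I01)
  (coneX' k rho a r - (coneX k rho a 1 - coneX k rho a 0)) ^+ 2.
Definition excessY k rho a := \int[mu]_(r in I01)
  (coneY' k rho a r - (coneY k rho a 1 - coneY k rho a 0)) ^+ 2.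

Lemma action_excess : action (k ^+ 2) rho a =
  ((coneX k rho a 1 - coneX k rho a 0) ^+ 2
   + (coneY k rho a 1 - coneY k rho a 0) ^+ 2
   + (excessX k rho a + excessY k rho a))%:E.
Proof.
have iX := L2_integrable_sqr coneX'_L2; have iY := L2_integrable_sqr coneY'_L2.
rewrite action_cone -[LHS]fineK; last first.
  by have := @integrable_fin_num _ _ _ mu I01 _ _ isqr; apply.
rewrite -[fine _]/(\int[mu]_(s in I01) (_ + _)) RintegralD//.
rewrite (excess_eq coneX_continuous coneX'_L2 coneX_primitive).
rewrite (excess_eq coneY_continuous coneY'_L2 coneY_primitive).
by congr (_%:E); rewrite addrACA.
Qed.

End Lift.

Lemma excessX_ge0 k rho a : 0 <= excessX k rho a.
Proof. by apply: Rintegral_ge0 => x _; exact: sqr_ge0. Qed.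

Lemma excessY_ge0 k rho a : 0 <= excessY k rho a.
Proof. by apply: Rintegral_ge0 => x _; exact: sqr_ge0. Qed.

(** Law of cosines in the triangle with apex 0, sides sqrt(a0) and sqrt(a1) and angle [k]. Only the
    endpoint values of [rho] and [a] enter. *)
Lemma cone_chord k (a0 a1 : R) rho a : 0 <= a0 -> 0 <= a1 ->
  admissible_rho rho -> admissible_a a0 a1 a ->
  (coneX k rho a 1 - coneX k rho a 0) ^+ 2
   + (coneY k rho a 1 - coneY k rho a 0) ^+ 2
  = a0 + a1 - 2 * Num.sqrt (a0 * a1) * cos k.
Proof.
move=> a00 a10 [_ r0 r1 _] [_ _ e0 e1].
rewrite /coneX /coneY r0 r1 e0 e1 mulr0 mulr1 cos0 sin0 sqrtrM//.
have := cos2Dsin2 k; have := sqr_sqrtr a00; have := sqr_sqrtr a10.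
move: (Num.sqrt a0) (Num.sqrt a1) (cos k) (sin k) => u v c S <- <- cs.
have -> : (v * c - u * 1) ^+ 2 + (v * S - u * 0) ^+ 2
  = v ^+ 2 * (c ^+ 2 + S ^+ 2) + u ^+ 2 - 2 * (u * v) * c by ring.
by rewrite cs; ring.
Qed.

Lemma action_ge_cos k (a0 a1 : R) rho a : 0 <= a0 -> 0 <= a1 ->
  admissible_rho rho -> admissible_a a0 a1 a ->
  ((a0 + a1 - 2 * Num.sqrt (a0 * a1) * cos k)%:E <= action (k ^+ 2) rho a)%E.
Proof.
move=> a00 a10 arho aa.
have [->|fin] := eqVneq (action (k ^+ 2) rho a) +oo%E; first exact: leey.
have [H1rho _ _ _] := arho; have [H1a apos _ _] := aa.
rewrite action_excess ?ltey// (cone_chord k a00 a10 arho aa) lee_fin lerDl.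
by apply: addr_ge0; [exact: excessX_ge0|exact: excessY_ge0].
Qed.

Lemma action_density_measurable k rho a : H1 rho -> H1 a ->
  (forall s, I01 s -> 0 < a s) ->
  measurable_fun I01 (fun s => (k ^+ 2 * weak_derivative rho s ^+ 2 * a s
    + weak_derivative a s ^+ 2 / (4 * a s))%:E).
Proof.
move=> H1rho H1a apos; apply/measurable_EFinP.
have mX := coneX'_measurable k H1rho H1a apos.
have mY := coneY'_measurable k H1rho H1a apos.
have : measurable_fun I01 (fun s => coneX' k rho a s ^+ 2 + coneY' k rho a s ^+ 2).
  by apply: measurable_funD; apply: measurable_funX.
apply: eq_measurable_fun => s; rewrite inE => s01.
by rewrite -cone_action_density.
Qed.

Lemma action_mono k l rho a : 0 <= k <= l -> H1 rho -> H1 a ->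
  (forall s, I01 s -> 0 < a s) ->
  (action (k ^+ 2) rho a <= action (l ^+ 2) rho a)%E.
Proof.
move=> /andP[k0 kl] H1rho H1a apos.
have mE q := action_density_measurable q H1rho H1a apos.
have pos q s : I01 s -> 0 <= q ^+ 2 * weak_derivative rho s ^+ 2 * a s
    + weak_derivative a s ^+ 2 / (4 * a s).
  by move=> s01; rewrite cone_action_density// addr_ge0 ?sqr_ge0.
apply: ge0_le_integral => //.
- by move=> s s01; rewrite lee_fin pos.
- exact: mE.
- exact: mE.
move=> s s01; rewrite lee_fin lerD2r ler_wpM2r ?(ltW (apos _ s01))//.
by rewrite ler_wpM2r ?sqr_ge0// lerXn2r ?nnegrE// (le_trans k0).
Qed.

(** For [L >= pi] the estimate with [k = L] would only give -cos L. Lowering the angular weight to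
    pi first decreases the action and yields the larger bound. *)
Lemma action_ge_cos_pi L (a0 a1 : R) rho a : 0 <= L -> 0 <= a0 -> 0 <= a1 ->
  admissible_rho rho -> admissible_a a0 a1 a ->
  ((a0 + a1 - 2 * Num.sqrt (a0 * a1) * cos_pi L)%:E <= action (L ^+ 2) rho a)%E.
Proof.
move=> L0 a00 a10 arho aa; rewrite /cos_pi; have [_|piL] := ltP L pi.
  exact: action_ge_cos.
rewrite -cospi; apply: (le_trans (action_ge_cos pi a00 a10 arho aa)).
have [H1rho _ _ _] := arho; have [H1a apos _ _] := aa.
by apply: action_mono => //; rewrite pi_ge0.
Qed.

End Cone.

(** * Curves through the apex *)

Section Apex.
Context {R : realType}.
Implicit Types (f g a rho : R -> R) (x y z k e d s t r h : R).
Local Notation mu := (@lebesgue_measure R).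
Local Notation I01 := (`]0, 1[%classic : set R).

Lemma sqr_sum3 x y z : (x + y + z) ^+ 2 <= 3 * (x ^+ 2 + y ^+ 2 + z ^+ 2).
Proof.
by have := sqr_ge0 (x - y); have := sqr_ge0 (x - z); have := sqr_ge0 (y - z); nra.
Qed.

Section Curve.
Variables (a0 a1 : R) (rho a : R -> R).
Hypotheses (adm_rho : admissible_rho rho) (adm_a : admissible_a a0 a1 a).
Hypothesis fin_action : (action (pi ^+ 2) rho a < +oo)%E.

Let K := Num.sqrt a0 + Num.sqrt a1.
(* For a0 = a1 = 0 the division by K = 0 gives theta = 0, and the identity
   K * theta = sqrt(a0) still holds. *)
Let theta := Num.sqrt a0 / K.
(** Abscissa of the limit segment, which runs along the real axis from sqrt(a0) to -sqrt(a1) and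
    meets the apex at [theta]. *)
Let ell s := Num.sqrt a0 - K * s.
Let X := coneX pi rho a.
Let Y := coneY pi rho a.
Let X' := coneX' pi rho a.
Let Y' := coneY' pi rho a.
Let E := excessX pi rho a + excessY pi rho a.

Let H1rho : H1 rho. Proof. by case: adm_rho. Qed.
Let H1a : H1 a. Proof. by case: adm_a. Qed.
Let a_gt0 s : I01 s -> 0 < a s. Proof. by case: adm_a => _ + _ _; apply. Qed.

Let K_ge0 : 0 <= K. Proof. by rewrite addr_ge0 ?sqrtr_ge0. Qed.

Let Ktheta : K * theta = Num.sqrt a0.
Proof.
rewrite /theta; have [K0|K0] := eqVneq K 0; last by rewrite mulrCA divff// mulr1.
rewrite K0 mul0r; apply/eqP; rewrite eq_le sqrtr_ge0/=.
by rewrite -K0 lerDl sqrtr_ge0.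
Qed.

Let ell_sqr s : ell s ^+ 2 = K ^+ 2 * (s - theta) ^+ 2.
Proof. by rewrite /ell -Ktheta; ring. Qed.

Let ell_bound s : I01 s -> ell s ^+ 2 <= K ^+ 2.
Proof.
rewrite I01_P => /andP[s0 s1]; have := sqrtr_ge0 a0; have := sqrtr_ge0 a1.
rewrite /ell /K; move: (Num.sqrt a0) (Num.sqrt a1) => u v v0 u0.
have h1 : 0 <= (u + v) * s by rewrite mulr_ge0; lra.
have h2 : (u + v) * s <= u + v by rewrite ler_piMr; lra.
by nra.
Qed.

Let E_ge0 : 0 <= E. Proof. by apply: addr_ge0; [exact: excessX_ge0|exact: excessY_ge0]. Qed.

Let endX : (X 0 = Num.sqrt a0) * (X 1 - Num.sqrt a0 = - K).
Proof.
case: adm_rho => _ r0 r1 _; case: adm_a => _ _ e0 e1.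
rewrite /X /coneX r0 r1 e0 e1 mulr0 mulr1 cos0 cospi /K.
by split; ring.
Qed.

Let endY : (Y 0 = 0) * (Y 1 = 0).
Proof.
case: adm_rho => _ r0 r1 _; case: adm_a => _ _ e0 e1.
by rewrite /Y /coneY r0 r1 e0 e1 mulr0 mulr1 sin0 sinpi !mulr0.
Qed.

Let X'2 : L2 X' := coneX'_L2 H1rho H1a a_gt0 fin_action.
Let Y'2 : L2 Y' := coneY'_L2 H1rho H1a a_gt0 fin_action.

Let devX s : I01 s -> (X s - ell s) ^+ 2 <= E.
Proof.
rewrite I01_P => /andP[s0 s1].
have := excess_dev (coneX_continuous H1rho H1a) X'2
  (coneX_primitive pi H1rho H1a a_gt0) (ltW s0) (ltW s1).
rewrite -[coneX _ _ _]/X !endX => h.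
have -> : X s - ell s = X s - (Num.sqrt a0 + s * - K) by rewrite /ell; ring.
apply: (le_trans h); rewrite /E /excessX -[coneX _ _ _]/X !endX lerDl.
exact: excessY_ge0.
Qed.

Let devY s : I01 s -> Y s ^+ 2 <= E.
Proof.
rewrite I01_P => /andP[s0 s1].
have := excess_dev (coneY_continuous H1rho H1a) Y'2
  (coneY_primitive pi H1rho H1a a_gt0) (ltW s0) (ltW s1).
rewrite -[coneY _ _ _]/Y !endY subr0 mulr0 addr0 subr0 => h.
apply: (le_trans h); rewrite /E /excessY -[coneY _ _ _]/Y !endY subr0 lerDr.
exact: excessX_ge0.
Qed.

(** [p] and [q] are the components of the velocity minus that of the segment, which is (-K, 0). *)
Let p s := X' s + K.
Let q s := Y' s.

Let p2 : L2 p. Proof. by apply: L2D => //; exact: L2_cst. Qed.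
Let q2 : L2 q. Proof. exact: Y'2. Qed.

Let int_pq : \int[mu]_(s in I01) (p s ^+ 2 + q s ^+ 2) = E.
Proof.
have ip := L2_integrable_sqr p2; have iq := L2_integrable_sqr q2.
rewrite RintegralD//.
rewrite /E /excessX /excessY -[coneX _ _ _]/X -[coneY _ _ _]/Y !endX !endY subr0.
by congr (_ + _); apply: eq_Rintegral => s _; rewrite ?opprK ?subr0.
Qed.

Let int_pq' : mu.-integrable I01 (EFin \o (fun s => p s ^+ 2 + q s ^+ 2)).
Proof. by apply: integrable_I01D; exact: L2_integrable_sqr. Qed.

Let limit_a s := K ^+ 2 * (s - theta) ^+ 2.

Let limit_der s : I01 s -> is_derive s 1 limit_a (2 * K ^+ 2 * (s - theta)).
Proof.
move=> _; apply: (@is_derive_quadratic _ _ _ _ (K ^+ 2)) => h.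
rewrite (_ : _ - _ - _ = K ^+ 2 * h ^+ 2); last by rewrite /limit_a; ring.
by rewrite ger0_norm// mulr_ge0 ?sqr_ge0.
Qed.

Let limit_wd : {ae mu, forall s, I01 s ->
  weak_derivative limit_a s = 2 * K ^+ 2 * (s - theta)}.
Proof.
apply: (@C1_weak_derivative_ae _ limit_a) => //; apply: continuous_subspaceT => x.
by apply: cvgM; [exact: cvg_cst|apply: cvgB; [exact: cvg_id|exact: cvg_cst]].
Qed.

(** With u = X - ell one has a - ell^2 = u^2 + 2 u ell + Y^2. The assumption [E <= 1] absorbs the
    quartic terms of the square, leaving a bound linear in [E]. *)
Let a_dev s : I01 s -> E <= 1 ->
  (a s - limit_a s) ^+ 2 <= 12 * (K ^+ 2 + 1) * E.
Proof.
move=> s01 E1; rewrite /limit_a -ell_sqr (cone_sqr pi rho a_gt0 s01) -/(X s) -/(Y s).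
have := devX s01; have := devY s01; have := ell_bound s01.
move: (X s) (Y s) (ell s) => x y l lK yE xE.
set u := x - l in xE; have -> : x = u + l by rewrite /u; ring.
have -> : (u + l) ^+ 2 + y ^+ 2 - l ^+ 2 = u ^+ 2 + 2 * u * l + y ^+ 2 by ring.
have h1 : u ^+ 2 * u ^+ 2 <= E.
  by rewrite -[leRHS]mulr1 ler_pM ?sqr_ge0// (le_trans xE).
have h2 : y ^+ 2 * y ^+ 2 <= E.
  by rewrite -[leRHS]mulr1 ler_pM ?sqr_ge0// (le_trans yE).
have h3 : u ^+ 2 * l ^+ 2 <= E * K ^+ 2 by rewrite ler_pM ?sqr_ge0.
have h4 : (u ^+ 2 + 2 * u * l + y ^+ 2) ^+ 2 <=
    3 * (u ^+ 2 * u ^+ 2 + 4 * (u ^+ 2 * l ^+ 2) + y ^+ 2 * y ^+ 2).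
  by have := sqr_sum3 (u ^+ 2) (2 * u * l) (y ^+ 2); nra.
apply: (le_trans h4); have := E_ge0; lra.
Qed.

Let da_dev s : I01 s -> E <= 1 ->
  (weak_derivative a s - 2 * K ^+ 2 * (s - theta)) ^+ 2
    <= 24 * (K ^+ 2 + 1) * (E + (p s ^+ 2 + q s ^+ 2)).
Proof.
move=> s01 E1; rewrite (cone_radial pi rho a_gt0 s01) -/(X s) -/(Y s) -/(X' s) -/(Y' s).
have -> : 2 * K ^+ 2 * (s - theta) = - (2 * K * ell s).
  by rewrite /ell -Ktheta; ring.
have := devX s01; have := devY s01; have := ell_bound s01.
have -> : X' s = p s - K by rewrite /p; ring.
rewrite -/(q s).
move: (X s) (Y s) (ell s) (p s) (q s) => x y l P Q lK yE xE.
set u := x - l in xE; have -> : x = u + l by rewrite /u; ring.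
have -> : 2 * ((u + l) * (P - K) + y * Q) - - (2 * K * l) =
  2 * ((u + l) * P - K * u + y * Q) by ring.
have h1 : (u + l) ^+ 2 * P ^+ 2 <= (2 + 2 * K ^+ 2) * P ^+ 2.
  by rewrite ler_wpM2r ?sqr_ge0//; have := sqr_ge0 (u - l); nra.
have h2 : y ^+ 2 * Q ^+ 2 <= Q ^+ 2.
  by rewrite ler_piMl ?sqr_ge0// (le_trans yE).
have h3 : K ^+ 2 * u ^+ 2 <= K ^+ 2 * E by rewrite ler_wpM2l ?sqr_ge0.
(* The factor 12 is 2^2 times the 3 of [sqr_sum3]; the further 2 in the claim comes from [h1]. *)
have h4 : (2 * ((u + l) * P - K * u + y * Q)) ^+ 2 <=
    12 * ((u + l) ^+ 2 * P ^+ 2 + K ^+ 2 * u ^+ 2 + y ^+ 2 * Q ^+ 2).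
  rewrite -!exprMn; move: ((u + l) * P) (K * u) (y * Q) => A B C.
  by have := sqr_sum3 A (- B) C; nra.
apply: (le_trans h4).
have K2 := sqr_ge0 K; have := sqr_ge0 P; have := sqr_ge0 Q.
have := mulr_ge0 K2 (sqr_ge0 Q); have := E_ge0; nra.
Qed.

Lemma apex_H1_dist : E <= 1 ->
  (\int[mu]_(s in I01) ((a s - limit_a s) ^+ 2
      + (weak_derivative a s - weak_derivative limit_a s) ^+ 2)%:E
    <= (72 * (K ^+ 2 + 1) * E)%:E)%E.
Proof.
(* 36 is the sum of the constants 12 and 24 in [a_dev] and [da_dev]. It doubles to 72 because E +
   p^2 + q^2 has integral [2 * E]. *)
move=> E1; pose M := 36 * (K ^+ 2 + 1).
have M0 : 0 <= M by rewrite /M mulr_ge0// addr_ge0// sqr_ge0.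
have wa2 := H1_L2_weak_derivative H1a.
have cl : {within `[0, 1], continuous limit_a}.
  apply: continuous_subspaceT => x; apply: cvgM; first exact: cvg_cst.
  by apply: cvgM; apply: cvgB; [exact: cvg_id|exact: cvg_cst|exact: cvg_id|exact: cvg_cst].
have cdl : {within `[0, 1], continuous (fun s => 2 * K ^+ 2 * (s - theta))}.
  apply: continuous_subspaceT => x.
  by apply: cvgM; [exact: cvg_cst|apply: cvgB; [exact: cvg_id|exact: cvg_cst]].
have wl2 := H1_L2_weak_derivative (C1_H1 cl cdl limit_der).
have bound_int : mu.-integrable I01
    (EFin \o (fun s => M * (E + (p s ^+ 2 + q s ^+ 2)))).
  by apply: integrable_I01Z; apply: integrable_I01D => //; exact: integrable_I01_cst.
have -> : 72 * (K ^+ 2 + 1) * E = \int[mu]_(s in I01) (M * (E + (p s ^+ 2 + q s ^+ 2))).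
  rewrite RintegralZl//; last by apply: integrable_I01D => //; exact: integrable_I01_cst.
  rewrite RintegralD//; last exact: integrable_I01_cst.
  by rewrite Rintegral_I01_cst int_pq /M; ring.
rewrite /Rintegral fineK; last first.
  by have := @integrable_fin_num _ _ _ mu I01 _ _ bound_int; apply.
have mb : measurable_fun I01 (fun s => (M * (E + (p s ^+ 2 + q s ^+ 2)))%:E).
  exact: measurable_int bound_int.
have pq0 s : 0 <= p s ^+ 2 + q s ^+ 2 by rewrite addr_ge0 ?sqr_ge0.
have H2a : L2 a by case: H1a.
have [ma _] := H2a; have [ml _] := within_L2 cl.
apply: ae_ge0_le_integral => //.
- by move=> s _; rewrite lee_fin addr_ge0 ?sqr_ge0.
- apply/measurable_EFinP; apply: measurable_funD; apply: measurable_funX.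
    exact: measurable_funB.
  by apply: measurable_funB; [exact: L2_measurable wa2|exact: L2_measurable wl2].
- by move=> s _; rewrite lee_fin mulr_ge0// addr_ge0.
apply: filterS limit_wd; first exact: (ae_filter_ringOfSetsType mu).
move=> s + s01 => /(_ s01) ->; rewrite lee_fin.
have h1 := a_dev s01 E1; have h2 := da_dev s01 E1; have pq := pq0 s.
apply: (le_trans (lerD h1 h2)).
have : 0 <= K ^+ 2 + 1 by rewrite addr_ge0// sqr_ge0.
have := E_ge0; move: pq; rewrite /M.
move: (K ^+ 2 + 1) (p s ^+ 2 + q s ^+ 2) E => A B e B0 e0 A0.
by have := mulr_ge0 A0 B0; have := mulr_ge0 A0 e0; lra.
Qed.

Let int_norm_le f e : L2 f -> 0 <= e -> \int[mu]_(s in I01) f s ^+ 2 <= e ^+ 2 ->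
  \int[mu]_(s in I01) `|f s| <= e.
Proof.
move=> f2 e0 fe; have := sqr_Rintegral_le (L2_norm f2).
under [X in _ <= X -> _]eq_Rintegral do rewrite real_normK ?num_real//.
move=> /le_trans/(_ fe); rewrite ler_sqr ?nnegrE//; exact: Rintegral_ge0.
Qed.

(** Monotonicity makes rho' a probability density. This L^1 bound survives however strongly rho'
    concentrates. *)
Lemma rho'_integral : \int[mu]_(s in I01) `|weak_derivative rho s| = 1.
Proof.
have [_ r0 r1 rho'0] := adm_rho.
have i1 := L2_integrable (H1_L2_weak_derivative H1rho).
have -> : \int[mu]_(s in I01) `|weak_derivative rho s| =
    \int[mu]_(s in I01) weak_derivative rho s.
  congr fine; apply: ae_eq_integral => //.
  - by apply: measurable_int (integrable_norm i1).
  - by apply: measurable_int i1.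
  apply: filterS rho'0; first exact: (ae_filter_ringOfSetsType mu).
  by move=> s + s01 => /(_ s01) h; rewrite ger0_norm.
have crho : {within `[0, 1], continuous rho} by case: H1rho.
have := primitive01_cc crho i1 (H1_primitive H1rho) ler01 (lexx 1).
by rewrite r0 r1 subr0 Rintegral_I01_cc.
Qed.

(** Away from [theta] the abscissa X stays at distance [m] from 0. Dividing a pi rho' = X Y' - Y X'
    by X^2 <= a and using pi >= 1 bounds rho' by terms whose means are small with [e]. *)
Let rho'_far m e s : 0 < m -> 0 < e -> E <= e ^+ 2 ->
  e + m <= K * `|s - theta| -> I01 s ->
  `|weak_derivative rho s| <= m^-1 * `|q s| + e / m ^+ 2 * (K + `|p s|).
Proof.
move=> m0 e0 Ee far s01.
have xl : `|X s - ell s| <= e.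
  rewrite -ler_sqr ?nnegrE ?(ltW e0)// real_normK ?num_real//.
  exact: le_trans (devX s01) Ee.
have ye : `|Y s| <= e.
  rewrite -ler_sqr ?nnegrE ?(ltW e0)// real_normK ?num_real//.
  exact: le_trans (devY s01) Ee.
have el : `|ell s| = K * `|s - theta|.
  have -> : ell s = - (K * (s - theta)) by rewrite /ell -Ktheta; ring.
  by rewrite normrN normrM (ger0_norm K_ge0).
have xm : m <= `|X s|.
  have := ler_normB (X s) (X s - ell s).
  by rewrite (_ : _ - (_ - _) = ell s); [lra|ring].
have Xpos : 0 < `|X s| by exact: lt_le_trans xm.
have Ea := cone_angular pi rho a_gt0 s01.
have As := cone_sqr pi rho a_gt0 s01.
rewrite -/(X s) -/(Y s) -/(X' s) -/(Y' s) -/(q s) in Ea As.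
have X'E : X' s = p s - K by rewrite /p; ring.
rewrite X'E in Ea.
have n1 : `|X s| ^+ 2 * `|weak_derivative rho s| <=
    `|X s| * `|q s| + e * (K + `|p s|).
  have h1 : `|X s| ^+ 2 * `|weak_derivative rho s|
      <= `|a s * (pi * weak_derivative rho s)|.
    have -> : `|a s * (pi * weak_derivative rho s)| = a s * (pi * `|weak_derivative rho s|).
      by rewrite !normrM (ger0_norm (ltW (a_gt0 s01))) (ger0_norm (pi_ge0 R)).
    have h0 : `|X s| ^+ 2 <= a s by rewrite real_normK ?num_real// As lerDl sqr_ge0.
    apply: ler_pM => //.
    by rewrite ler_peMl// (le_trans _ (pi_ge2 R))// ler1n.
  apply: (le_trans h1); rewrite Ea (le_trans (ler_normB _ _))//.
  rewrite (normrM (X s)) (normrM (Y s)) lerD//.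
  apply: ler_pM => //; rewrite (le_trans (ler_normB _ _))// (ger0_norm K_ge0) addrC//.
have K' : 0 <= K + `|p s| by rewrite addr_ge0.
move: n1 xm Xpos; move: (`|X s|) (`|q s|) (normr_ge0 (q s)) (K + _) K'
  (`|weak_derivative rho s|) => x Q Q0 P P0 w n1 mx x0.
have x2 : 0 < x ^+ 2 by rewrite exprn_gt0.
have h1 : w <= (x * Q + e * P) / x ^+ 2 by rewrite ler_pdivlMr// mulrC.
apply: (le_trans h1).
have -> : (x * Q + e * P) / x ^+ 2 = x^-1 * Q + e * P / x ^+ 2 by field; lra.
rewrite lerD//; first by rewrite ler_wpM2r// lef_pV2.
rewrite mulrAC; apply: ler_wpM2r => //; apply: ler_wpM2l; first exact: ltW.
by rewrite lef_pV2 ?posrE ?exprn_gt0// lerXn2r ?nnegrE// ltW.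
Qed.

(** As rho' has mass one, the difference is the integral of (phi - phi theta) rho'. Within distance
    [d] of [theta] it costs [eps]; farther out [phi] varies by at most [2 * M] and [rho'_far] bounds
    rho'. *)
Lemma apex_dirac (phi : R -> R) (M m e d eps : R) :
  0 < m -> 0 < e -> E <= e ^+ 2 -> e + m <= K * d -> 0 <= M -> 0 <= eps ->
  measurable_fun I01 phi -> (forall s, I01 s -> `|phi s| <= M) ->
  `|phi theta| <= M ->
  (forall s, I01 s -> `|s - theta| < d -> `|phi s - phi theta| <= eps) ->
  `|\int[mu]_(s in I01) (phi s * weak_derivative rho s) - phi theta|
    <= eps + 2 * M * (m^-1 * e + e / m ^+ 2 * (K + e)).
Proof.
move=> m0 e0 Ee emK M0 eps0 mphi phiM phitM near_phi.
have i1 := L2_integrable (H1_L2_weak_derivative H1rho).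
have in1 := integrable_norm i1.
have e0' := ltW e0.
have intp : \int[mu]_(s in I01) `|p s| <= e.
  apply: int_norm_le => //; apply: le_trans Ee; rewrite -int_pq.
  apply: le_Rintegral => //; first exact: L2_integrable_sqr.
  by move=> s _; rewrite lerDl sqr_ge0.
have intq : \int[mu]_(s in I01) `|q s| <= e.
  apply: int_norm_le => //; apply: le_trans Ee; rewrite -int_pq.
  apply: le_Rintegral => //; first exact: L2_integrable_sqr.
  by move=> s _; rewrite lerDr sqr_ge0.
pose c2 := e / m ^+ 2.
have c20 : 0 <= c2 by rewrite divr_ge0// exprn_ge0// ltW.
pose D s := m^-1 * `|q s| + c2 * (K + `|p s|).
have inp := L2_integrable (L2_norm p2); have inq := L2_integrable (L2_norm q2).
have ic := @integrable_I01_cst R K.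
have iKp := integrable_I01D ic inp.
have iD : mu.-integrable I01 (EFin \o D).
  by apply: integrable_I01D; apply: integrable_I01Z.
have intD : \int[mu]_(s in I01) D s <= m^-1 * e + c2 * (K + e).
  rewrite RintegralD//; last 2 first.
  - exact: integrable_I01Z.
  - exact: integrable_I01Z.
  rewrite RintegralZl// RintegralZl// RintegralD// Rintegral_I01_cst.
  by rewrite lerD ?ler_wpM2l ?invr_ge0 ?(ltW m0)// lerD2l.
have D0 s : 0 <= D s.
  by rewrite addr_ge0// mulr_ge0 ?invr_ge0 ?(ltW m0)// addr_ge0.
have iphi : mu.-integrable I01 (EFin \o (fun s => phi s * weak_derivative rho s)).
  apply: (@integrable_I01_le _ _ (fun s => M * `|weak_derivative rho s|)).
  - apply: measurable_funM => //.
    exact: L2_measurable (H1_L2_weak_derivative H1rho).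
  - by move=> s s01; rewrite normrM ler_wpM2r// phiM.
  - exact: integrable_I01Z.
have ithe : mu.-integrable I01 (EFin \o (fun s => phi theta * weak_derivative rho s)).
  exact: integrable_I01Z.
have -> : \int[mu]_(s in I01) (phi s * weak_derivative rho s) - phi theta =
    \int[mu]_(s in I01) (phi s * weak_derivative rho s - phi theta * weak_derivative rho s).
  rewrite RintegralB// RintegralZl//.
  have crho : {within `[0, 1], continuous rho} by case: H1rho.
  have := primitive01_cc crho i1 (H1_primitive H1rho) ler01 (lexx 1).
  have [_ r0 r1 _] := adm_rho.
  by rewrite r0 r1 subr0 Rintegral_I01_cc// => <-; rewrite mulr1.
have idiff := integrable_I01B iphi ithe.
apply: (le_trans (le_normr_Rintegral _ idiff)) => //.
have ib : mu.-integrable I01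
    (EFin \o (fun s => eps * `|weak_derivative rho s| + 2 * M * D s)).
  by apply: integrable_I01D; apply: integrable_I01Z.
apply: (@le_trans _ _ (\int[mu]_(s in I01)
    (eps * `|weak_derivative rho s| + 2 * M * D s))).
  apply: le_Rintegral => //; first exact: integrable_norm idiff.
  move=> s s01; rewrite -mulrBl normrM.
  have [sd|sd] := ltP `|s - theta| d.
    rewrite (@le_trans _ _ (eps * `|weak_derivative rho s|))//.
      by rewrite ler_wpM2r// near_phi.
    by rewrite lerDl !mulr_ge0.
  have w : `|weak_derivative rho s| <= D s.
    by apply: rho'_far => //; apply: (le_trans emK); rewrite ler_wpM2l.
  rewrite (@le_trans _ _ (2 * M * D s))//; last by rewrite lerDr mulr_ge0.
  apply: ler_pM => //; rewrite (le_trans (ler_normB _ _))//.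
  by rewrite (mulrDl 1 1) mul1r lerD// phiM.
rewrite RintegralD//; last 2 first.
- exact: integrable_I01Z.
- exact: integrable_I01Z.
rewrite RintegralZl// RintegralZl// rho'_integral mulr1 lerD2l.
by apply: ler_wpM2l => //; rewrite mulr_ge0.
Qed.

End Curve.
End Apex.

(** * Minimizing sequences for large distances *)

Section Convergence.
Context {R : realType}.
Local Notation mu := (@lebesgue_measure R).
Local Notation I01 := (`]0, 1[%classic : set R).
Variables (L a0 a1 : R) (rho a : nat -> R -> R).
Hypotheses (piL : pi <= L) (a0_ge0 : 0 <= a0) (a1_ge0 : 0 <= a1).
Hypothesis JE : J (L ^+ 2) a0 a1 = (a0 + a1 + 2 * Num.sqrt (a0 * a1))%:E.
Hypothesis minim : minimizing_sequence (L ^+ 2) a0 a1 rho a.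

Let K := Num.sqrt a0 + Num.sqrt a1.
Let theta := Num.sqrt a0 / K.
Let E n := excessX pi (rho n) (a n) + excessY pi (rho n) (a n).

Let adm_rho n : admissible_rho (rho n). Proof. by case: minim. Qed.
Let adm_a n : admissible_a a0 a1 (a n). Proof. by case: minim. Qed.

Lemma apex_theta01 : 0 <= theta <= 1.
Proof.
have u0 := sqrtr_ge0 a0; have v0 := sqrtr_ge0 a1.
rewrite /theta /K; have [->|K0] := eqVneq (Num.sqrt a0 + Num.sqrt a1) 0.
  by rewrite invr0 mulr0 lexx ler01.
have K1 : 0 < Num.sqrt a0 + Num.sqrt a1 by rewrite lt_neqAle eq_sym K0 addr_ge0.
by rewrite divr_ge0 ?addr_ge0//= ler_pdivrMr// mul1r lerDl.
Qed.

(** The pi-action is at most the L-action, while its lower bound is the L-infimum. Hence the excess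
    of the pi-lift is at most the gap between the L-action and its infimum. *)
Lemma near_small_excess d : 0 < d ->
  \forall n \near \oo, (action (pi ^+ 2) (rho n) (a n) < +oo)%E /\ E n <= d.
Proof.
move=> d0; have [_ _] := minim; rewrite JE => /fine_cvgP[fin /cvgrPdist_lt/(_ d d0) cv].
near=> n.
have finL : action (L ^+ 2) (rho n) (a n) \is a fin_num by near: n.
have cvn : `|a0 + a1 + 2 * Num.sqrt (a0 * a1) - fine (action (L ^+ 2) (rho n) (a n))| < d.
  by near: n.
have [H1rho _ _ _] := adm_rho n; have [H1a apos _ _] := adm_a n.
have mono : (action (pi ^+ 2) (rho n) (a n) <= action (L ^+ 2) (rho n) (a n))%E.
  by apply: action_mono => //; rewrite pi_ge0.
have fin_pi : (action (pi ^+ 2) (rho n) (a n) < +oo)%E.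
  by apply: le_lt_trans mono _; rewrite ltey_eq finL.
split => //; move: mono.
rewrite (action_excess H1rho H1a apos fin_pi).
rewrite (cone_chord pi a0_ge0 a1_ge0 (adm_rho n) (adm_a n)) cospi.
rewrite -(fineK finL) lee_fin -/(E n).
move: cvn; rewrite ltr_norml => /andP[+ _].
move: (fine _) => F; lra.
Unshelve. all: by end_near. Qed.

Lemma apex_H1_cvg : H1_cvg a (fun s => K ^+ 2 * (s - theta) ^+ 2).
Proof.
pose C := 72 * (K ^+ 2 + 1).
have C0 : 0 < C by rewrite mulr_gt0// ltr_wpDl// sqr_ge0.
have bound e : 0 < e -> \forall n \near \oo,
    (0 <= \int[mu]_(s in I01) ((a n s - K ^+ 2 * (s - theta) ^+ 2) ^+ 2
      + (weak_derivative (a n) s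
         - weak_derivative (fun s => K ^+ 2 * (s - theta) ^+ 2) s) ^+ 2)%:E <= e%:E)%E.
  move=> e0; have d0 : 0 < Num.min 1 (e / C) by rewrite lt_min ltr01 divr_gt0.
  apply: filterS (near_small_excess d0) => n [fin].
  rewrite le_min => /andP[E1 EC]; apply/andP; split.
    by apply: integral_ge0 => s _; rewrite lee_fin addr_ge0 ?sqr_ge0.
  apply: (le_trans (apex_H1_dist (adm_rho n) (adm_a n) fin E1)).
  by rewrite lee_fin mulrC -ler_pdivlMr.
rewrite /H1_cvg; apply/fine_cvgP; split.
  apply: filterS (bound 1 ltr01) => n /andP[i0 i1].
  by rewrite ge0_fin_numE// (le_lt_trans i1)// ltry.
apply/cvgrPdist_le => e e0; apply: filterS (bound e e0) => n /andP[i0 i1].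
have fin : (\int[mu]_(s in I01) ((a n s - K ^+ 2 * (s - theta) ^+ 2) ^+ 2
      + (weak_derivative (a n) s
         - weak_derivative (fun s => K ^+ 2 * (s - theta) ^+ 2) s) ^+ 2)%:E)%E \is a fin_num.
  by rewrite ge0_fin_numE// (le_lt_trans i1)// ltry.
rewrite /= sub0r normrN ger0_norm ?fine_ge0//.
by rewrite -lee_fin fineK.
Qed.

(** Positivity of [a0 + a1] gives [K > 0], so that closeness to the segment forces distance from the
    apex away from [theta]. For [a0 = a1 = 0] the segment is the apex itself and rho' need not
    concentrate. *)
Lemma apex_cvg_to_dirac : 0 < a0 + a1 ->
  cvg_to_dirac (fun n => weak_derivative (rho n)) theta.
Proof.
move=> a_pos phi cphi.
have K0 : 0 < K.
  rewrite lt_neqAle addr_ge0 ?sqrtr_ge0// andbT eq_sym paddr_eq0 ?sqrtr_ge0//.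
  by apply/negP => /andP[]; rewrite !sqrtr_eq0 => h1 h2; move: a_pos; lra.
have /andP[th0 th1] := apex_theta01.
have thI : `[0, 1]%classic theta by rewrite /= in_itv/= th0.
have [mphi _] := within_L2 cphi.
have mphic : measurable_fun (`[0, 1]%classic : set R) phi.
  exact: subspace_continuous_measurable_fun.
have -> : \int[\d_theta]_(s in `[0, 1]) phi s = phi theta.
  rewrite /Rintegral (integral_dirac theta); last 2 first.
  - by [].
  - exact/measurable_EFinP.
  by rewrite diracE mem_set// mul1e.
have := continuous_compact cphi (@segment_compact _ 0 1).
move=> /compact_bounded [M0 [_ MP0]].
pose M := Num.max 0 (M0 + 1).
have M_ge0 : 0 <= M by rewrite /M le_max lexx.
have phiM s : 0 <= s <= 1 -> `|phi s| <= M.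
  move=> s01; rewrite le_max; apply/orP; right.
  by apply: (MP0 (M0 + 1)); [rewrite ltrDl|exists s => //=; rewrite in_itv].
apply/cvgrPdist_le => eps eps0.
have /subspace_continuousP/(_ theta thI)/cvgrPdist_le/(_ (eps / 2)) := cphi.
move=> /(_ _)/nbhs_ballP[|d /= d0 dP]; first by rewrite divr_gt0.
(* Half of [K * d], the other half being left for [e], as [apex_dirac] asks for [e + m <= K * d]. *)
pose m := K * d / 2; have m0 : 0 < m by rewrite divr_gt0// mulr_gt0.
pose B := 2 * M * (m^-1 + (m ^+ 2)^-1 * (K + 1)).
have B0 : 0 <= B.
  rewrite mulr_ge0 ?mulr_ge0// addr_ge0 ?invr_ge0 ?(ltW m0)//.
  by rewrite mulr_ge0 ?invr_ge0 ?exprn_ge0 ?(ltW m0)// addr_ge0// ltW.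
(* The bound [e <= 1] replaces [K + e] by [K + 1], after which the far contribution is at most
   [e * B]. *)
pose e := Num.min (Num.min m 1) (eps / 2 / (B + 1)).
have B1 : 0 < B + 1 by rewrite ltr_wpDl.
have e0 : 0 < e by rewrite !lt_min m0 ltr01 !divr_gt0.
have [em e1 eB] : [/\ e <= m, e <= 1 & e <= eps / 2 / (B + 1)].
  by rewrite !ge_min !lexx ?orbT.
have e20 : 0 < e ^+ 2 by rewrite exprn_gt0.
apply: filterS (near_small_excess e20) => n [fin En].
rewrite distrC.
have emd : e + m <= K * d by rewrite /m in em *; lra.
have eps20 : 0 <= eps / 2 by rewrite divr_ge0// ltW.
have near_phi s : I01 s -> `|s - theta| < d -> `|phi s - phi theta| <= eps / 2.
  move=> s01 sd; rewrite distrC; apply: dP; first by rewrite /ball/= distrC.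
  by apply: subset_itv s01; rewrite bnd_simp.
have phiM' s : I01 s -> `|phi s| <= M.
  by rewrite I01_P => /andP[s0 s1]; apply: phiM; rewrite !ltW.
have phitM : `|phi theta| <= M by apply: phiM; rewrite th0.
have := apex_dirac (adm_rho n) (adm_a n) fin m0 e0 En emd M_ge0 eps20
  mphi phiM' phitM near_phi.
move=> /le_trans; apply.
have -> : eps = eps / 2 + eps / 2 by field.
rewrite {1}(_ : eps / 2 + eps / 2 = eps); last by field.
rewrite lerD2l (@le_trans _ _ (e * B))//.
  have -> : e * B = 2 * M * (m^-1 * e + e / m ^+ 2 * (K + 1)) by rewrite /B; ring.
  rewrite ler_wpM2l ?mulr_ge0// lerD2l ler_wpM2l//; last by rewrite lerD2l.
  by rewrite divr_ge0 ?exprn_ge0 ?(ltW m0) ?(ltW e0).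
rewrite (@le_trans _ _ (e * (B + 1)))//; last by rewrite -ler_pdivlMr.
by rewrite ler_wpM2l ?(ltW e0)// lerDl.
Qed.

End Convergence.

(** * The explicit minimizer *)

Section Explicit.
Context {R : realType}.
Implicit Types (f g a rho : R -> R) (x y z k e d s t r h : R).
Local Notation mu := (@lebesgue_measure R).
Local Notation I01 := (`]0, 1[%classic : set R).

Lemma atanV x : 0 < x -> atan x^-1 = pi / 2 - atan x.
Proof.
move=> x0; have t0 : 0 < atan x by rewrite -atan0 lt_atan.
have t1 := atan_ltpi2 x.
have -> : x^-1 = tan (pi / 2 - atan x); last first.
  by rewrite tanK// in_itv/=; have p0 := pi_gt0 R; apply/andP; split; lra.
rewrite -[x in x^-1]atanK /tan.
have -> : pi / 2 - atan x = - (atan x - pi / 2) by ring.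
by rewrite sinN cosN sinBpihalf cosBpihalf opprK invf_div.
Qed.

Lemma is_derive_affine f x d : (forall h, f (x + h) = f x + d * h) -> is_derive x 1 f d.
Proof.
move=> fP; apply: (@is_derive_quadratic _ _ _ _ 0) => h.
by rewrite fP mul0r addrAC addrK subrr normr0.
Qed.

Lemma is_derive_continuous f x d : is_derive x 1 f d -> {for x, continuous f}.
Proof.
move=> df; apply: differentiable_continuous; apply/derivable1_diffP.
exact: (@ex_derive _ _ _ _ _ _ _ df).
Qed.

Lemma action_const k rho a c : H1 rho -> H1 a -> (forall s, I01 s -> 0 < a s) ->
  {ae mu, forall s, I01 s -> k ^+ 2 * weak_derivative rho s ^+ 2 * a s
      + weak_derivative a s ^+ 2 / (4 * a s) = c} ->
  action (k ^+ 2) rho a = c%:E.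
Proof.
move=> H1rho H1a apos aec; rewrite /action.
transitivity (\int[mu]_(s in I01) c%:E)%E; last first.
  by rewrite integral_cst// [X in (_ * X)%E]mu_I01 mule1.
apply: ae_eq_integral => //; first exact: action_density_measurable.
apply: filterS aec; first exact: (ae_filter_ringOfSetsType mu).
by move=> s + s01 => /(_ s01) ->.
Qed.

Variables (L a0 a1 : R).
Hypotheses (L_ge0 : 0 <= L) (L_pi : L < pi) (a0_ge0 : 0 <= a0) (a1_ge0 : 0 <= a1).

Let u := Num.sqrt a0.
Let v := Num.sqrt a1.
Let c := cos L.
Let S := sin L.
(** [D] and [Y] are the Cartesian coordinates of the segment from (u, 0) to (v cos L, v sin L), and
    [D'], [Y'] its constant velocity. *)
Let D s := (1 - s) * u + s * c * v.
Let Y s := s * S * v.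
Let D' := c * v - u.
Let Y' := S * v.
Let aopt := a_opt L a0 a1.
Let aopt' s := 2 * (D s * D' + Y s * Y').

Let u_ge0 : 0 <= u. Proof. exact: sqrtr_ge0. Qed.
Let v_ge0 : 0 <= v. Proof. exact: sqrtr_ge0. Qed.
Let u2 : u ^+ 2 = a0. Proof. by rewrite sqr_sqrtr. Qed.
Let v2 : v ^+ 2 = a1. Proof. by rewrite sqr_sqrtr. Qed.
Let cS : c ^+ 2 + S ^+ 2 = 1. Proof. exact: cos2Dsin2. Qed.

Let S_ge0 : 0 <= S. Proof. by apply: sin_ge0_pi; rewrite L_ge0 ltW. Qed.

Let aoptE s : aopt s = D s ^+ 2 + Y s ^+ 2.
Proof.
rewrite /aopt /a_opt sqrtrM// -/u -/v -/c -u2 -v2.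
have -> : D s ^+ 2 + Y s ^+ 2 =
  (1 - s) ^+ 2 * u ^+ 2 + s ^+ 2 * v ^+ 2 * (c ^+ 2 + S ^+ 2) +
  2 * s * (1 - s) * (u * v) * c by rewrite /D /Y; ring.
by rewrite cS mulr1.
Qed.

Let speedE : D' ^+ 2 + Y' ^+ 2 = a0 + a1 - 2 * Num.sqrt (a0 * a1) * cos L.
Proof.
rewrite sqrtrM// -/u -/v -/c -u2 -v2.
have -> : D' ^+ 2 + Y' ^+ 2 =
  u ^+ 2 + v ^+ 2 * (c ^+ 2 + S ^+ 2) - 2 * (u * v) * c by rewrite /D' /Y'; ring.
by rewrite cS mulr1.
Qed.

Let dD s : is_derive s 1 D D'.
Proof. by apply: is_derive_affine => h; rewrite /D /D'; ring. Qed.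

Let dY s : is_derive s 1 Y Y'.
Proof. by apply: is_derive_affine => h; rewrite /Y /Y'; ring. Qed.

Let daopt s : is_derive s 1 aopt (aopt' s).
Proof.
apply: (@is_derive_quadratic _ _ _ _ (D' ^+ 2 + Y' ^+ 2)) => h; rewrite !aoptE.
rewrite (_ : _ - _ - _ = (D' ^+ 2 + Y' ^+ 2) * h ^+ 2); last first.
  by rewrite /aopt' /D /Y /D' /Y'; ring.
by rewrite ger0_norm// mulr_ge0 ?addr_ge0 ?sqr_ge0.
Qed.

Let caopt : continuous aopt.
Proof. by move=> x; exact: is_derive_continuous (daopt x). Qed.

Let cD : continuous D.
Proof. by move=> x; exact: is_derive_continuous (dD x). Qed.

Let cY : continuous Y.
Proof. by move=> x; exact: is_derive_continuous (dY x). Qed.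

Let caopt' : continuous aopt'.
Proof.
move=> x; apply: cvgM; first exact: cvg_cst.
by apply: cvgD; apply: cvgM; [exact: cD|exact: cvg_cst|exact: cY|exact: cvg_cst].
Qed.

Lemma a_opt_H1 : H1 aopt.
Proof.
by apply: (@C1_H1 _ aopt aopt') => //; exact: continuous_subspaceT.
Qed.

Let waopt : {ae mu, forall s, I01 s -> weak_derivative aopt s = aopt' s}.
Proof.
by apply: C1_weak_derivative_ae => //; exact: continuous_subspaceT.
Qed.

(** The segment misses the apex because the angle is less than pi: [Y] is positive if both [L] and
    [v] are, and otherwise [D] is. *)
Lemma a_opt_gt0 s : 0 < a0 + a1 -> I01 s -> 0 < aopt s.
Proof.
move=> a_pos; rewrite I01_P => /andP[s0 s1]; rewrite aoptE.
have [L0|L0] := eqVneq L 0.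
  have c1 : c = 1 by rewrite /c L0 cos0.
  rewrite ltr_pwDl ?sqr_ge0// exprn_gt0// /D c1 mulr1.
  have [u0|u0] := eqVneq u 0.
    have v0 : 0 < v by rewrite sqrtr_gt0; move: a_pos; rewrite -u2 u0; nra.
    by rewrite u0 mulr0 add0r mulr_gt0.
  have up : 0 < u by rewrite lt_neqAle eq_sym u0.
  by rewrite ltr_pwDl ?mulr_ge0 ?(ltW s0)// mulr_gt0// subr_gt0.
have Lp : 0 < L by rewrite lt_neqAle eq_sym L0.
have Sp : 0 < S by apply: sin_gt0_pi; rewrite Lp.
have [v0|v0] := eqVneq v 0.
  have up : 0 < u by rewrite sqrtr_gt0; move: a_pos; rewrite -v2 v0; nra.
  by rewrite ltr_pwDl ?sqr_ge0// exprn_gt0// /D v0 mulr0 addr0 mulr_gt0// subr_gt0.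
have vp : 0 < v by rewrite lt_neqAle eq_sym v0.
by rewrite ltr_pwDr ?sqr_ge0// exprn_gt0// !mulr_gt0.
Qed.

(** The hypothesis prescribes the angular momentum of the segment. The density is then its constant
    squared speed, by Lagrange's identity (D Y' - Y D')^2 + (D D' + Y Y')^2 = (D^2 + Y^2) (D'^2 +
    Y'^2). Keeping the product of [L] and rho' covers [L = 0]. *)
Lemma action_geodesic rho : 0 < a0 + a1 -> H1 rho ->
  {ae mu, forall s, I01 s ->
     L * weak_derivative rho s * aopt s = D s * Y' - Y s * D'} ->
  action (L ^+ 2) rho aopt = (a0 + a1 - 2 * Num.sqrt (a0 * a1) * cos L)%:E.
Proof.
move=> a_pos H1rho geo; rewrite -speedE.
apply: action_const => //; first exact: a_opt_H1.
  by move=> s; exact: a_opt_gt0.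
have := geo; apply: filterS2 waopt; first exact: (ae_filter_ringOfSetsType mu).
move=> s wa ge s01; rewrite wa//; have := ge s01; have := a_opt_gt0 a_pos s01.
rewrite /aopt' aoptE; move: (weak_derivative rho s) (D s) (Y s) => w x y p q.
have n0 : x ^+ 2 + y ^+ 2 != 0 by rewrite gt_eqF.
have -> : L ^+ 2 * w ^+ 2 * (x ^+ 2 + y ^+ 2) =
    (L * w * (x ^+ 2 + y ^+ 2)) ^+ 2 / (x ^+ 2 + y ^+ 2) by field.
by rewrite q; field.
Qed.

Lemma action_geodesic_eq0 rho : 0 < a0 + a1 -> H1 rho ->
  (forall s, I01 s -> D s * Y' - Y s * D' = 0) ->
  {ae mu, forall s, I01 s -> L * weak_derivative rho s = 0} ->
  action (L ^+ 2) rho aopt = (a0 + a1 - 2 * Num.sqrt (a0 * a1) * cos L)%:E.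
Proof.
move=> a_pos H1rho DY w0; apply: action_geodesic => //.
apply: filterS w0; first exact: (ae_filter_ringOfSetsType mu).
by move=> s + s01 => /(_ s01) ->; rewrite DY// mul0r.
Qed.

Let areal s : D s * Y' - Y s * D' = S * u * v.
Proof. by rewrite /D /Y /D' /Y'; ring. Qed.

Let rho_optD s : rho_opt L a0 a1 s =
  if 0 < D s then L^-1 * atan (Y s / D s)
  else if D s == 0 then pi / (2 * L) else L^-1 * atan (Y s / D s) + pi / L.
Proof. by []. Qed.

(** If one mass vanishes, the segment lies on a ray from the apex and its angle does not change in
    the interior. *)
Lemma rho_opt_const s t : a0 * a1 = 0 -> I01 s -> I01 t ->
  rho_opt L a0 a1 s = rho_opt L a0 a1 t.
Proof.
move=> a01; rewrite !I01_P => /andP[s0 s1] /andP[t0 t1]; rewrite !rho_optD.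
have /eqP := a01; rewrite mulf_eq0 => /orP[/eqP a00|/eqP a10].
  have u0 : u = 0 by rewrite /u a00 sqrtr0.
  have DE r : D r = r * (c * v) by rewrite /D u0; ring.
  have YE r : Y r = r * (S * v) by rewrite /Y; ring.
  have quot r : 0 < r -> Y r / D r = S * v / (c * v).
    by move=> r0; rewrite DE YE -mulf_div divff ?mul1r// gt_eqF.
  by rewrite !quot// !DE (pmulr_rgt0 _ s0) (pmulr_rgt0 _ t0) !mulf_eq0 (gt_eqF s0) (gt_eqF t0).
have v0 : v = 0 by rewrite /v a10 sqrtr0.
have DE r : D r = (1 - r) * u by rewrite /D v0; ring.
have YE r : Y r = 0 by rewrite /Y v0 mulr0.
have s1' : 0 < 1 - s by rewrite subr_gt0.
have t1' : 0 < 1 - t by rewrite subr_gt0.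
by rewrite !YE !mul0r !DE (pmulr_rgt0 _ s1') (pmulr_rgt0 _ t1') !mulf_eq0 (gt_eqF s1') (gt_eqF t1').
Qed.

(** The motion is purely radial: [rho_opt] has the weak derivative of a constant, and the angular
    momentum [S * u * v] is zero. *)
Lemma action_opt_degenerate : 0 < a0 + a1 -> a0 * a1 = 0 ->
  action (L ^+ 2) (rho_opt L a0 a1) aopt
    = (a0 + a1 - 2 * Num.sqrt (a0 * a1) * cos L)%:E.
Proof.
move=> a_pos a01; pose r0 : R := rho_opt L a0 a1 2^-1.
have I2 : I01 2^-1 by rewrite I01_P; apply/andP; split; lra.
have E : weak_derivative (rho_opt L a0 a1) = weak_derivative (cst r0 : R -> R).
  by apply: weak_derivative_eq => s s01; exact: rho_opt_const.
have -> : action (L ^+ 2) (rho_opt L a0 a1) aopt = action (L ^+ 2) (cst r0) aopt.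
  by rewrite /action E.
have cc k : {within `[0, 1], continuous (cst k : R -> R)}.
  by move=> x; exact: cvg_cst.
have dc s : I01 s -> is_derive s 1 (cst r0 : R -> R) (cst 0 s).
  by move=> _; exact: is_derive_cst.
apply: (action_geodesic_eq0 a_pos (C1_H1 (cc _) (cc _) dc)).
  move=> s _; rewrite areal -mulrA.
  by rewrite /u /v -sqrtrM// a01 sqrtr0 mulr0.
have := C1_weak_derivative_ae (cc 0) dc.
apply: filterS; first exact: (ae_filter_ringOfSetsType mu).
by move=> s + s01 => /(_ s01) ->; rewrite mulr0.
Qed.

Lemma action_opt_zero : a0 = 0 -> a1 = 0 ->
  action (L ^+ 2) (rho_opt L a0 a1) aopt = 0%E.
Proof.
move=> a00 a10; rewrite /action; transitivity (\int[mu]_(s in I01) 0)%E; last first.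
  by rewrite integral0.
apply: eq_integral => s _; have -> : aopt s = 0.
  by rewrite /aopt /a_opt a00 a10 !mul0r sqrtr0; ring.
(* Division by zero has value 0, so the quotient by [4 * a] vanishes together with [a_opt]. *)
by rewrite !mulr0 invr0 mulr0 addr0.
Qed.

Lemma action_opt_L0 rho : L = 0 -> 0 < a0 + a1 -> H1 rho ->
  action (L ^+ 2) rho aopt = (a0 + a1 - 2 * Num.sqrt (a0 * a1) * cos L)%:E.
Proof.
move=> L0 a_pos H1rho; apply: action_geodesic_eq0 => //.
  by move=> s _; rewrite areal /S L0 sin0 !mul0r.
by apply: aeW => s _; rewrite L0 mul0r.
Qed.

Lemma a_opt_admissible : 0 < a0 + a1 -> admissible_a a0 a1 aopt.
Proof.
move=> a_pos; split; first exact: a_opt_H1.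
- by move=> s; exact: a_opt_gt0.
- by rewrite /aopt /a_opt; ring.
- by rewrite /aopt /a_opt; ring.
Qed.

Hypotheses (L_gt0 : 0 < L) (a0_gt0 : 0 < a0) (a1_gt0 : 0 < a1).

Let u_gt0 : 0 < u. Proof. by rewrite sqrtr_gt0. Qed.
Let v_gt0 : 0 < v. Proof. by rewrite sqrtr_gt0. Qed.
Let S_gt0 : 0 < S. Proof. by apply: sin_gt0_pi; rewrite L_gt0. Qed.
Let Y_gt0 s : 0 < s -> 0 < Y s. Proof. by move=> s0; rewrite !mulr_gt0. Qed.
Let D0 : D 0 = u. Proof. by rewrite /D; ring. Qed.
Let Y0 : Y 0 = 0. Proof. by rewrite /Y !mul0r. Qed.

(* The arc tangent of d / y, unlike that of y / d, has no jump where the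
   segment crosses the axis d = 0. *)
Let psi s := L^-1 * (pi / 2 - atan (D s / Y s)).

(** The three cases of [rho_opt] are the branch corrections of one continuous angle: inverting the
    argument of [atan] produces pi/2 with the sign of [D s]. *)
Let rho_opt_psi s : 0 < s -> rho_opt L a0 a1 s = psi s.
Proof.
move=> s0; have Yp := Y_gt0 s0; rewrite rho_optD /psi.
case: ltP => [Dp|]; first by rewrite -invf_div atanV// divr_gt0.
rewrite le_eqVlt => /predU1P[->|Dn].
  by rewrite eqxx mul0r atan0 subr0 invfM; ring.
rewrite lt_eqF//.
have -> : Y s / D s = - (- D s / Y s)^-1 by rewrite invf_div invrN mulrN opprK.
rewrite atanN atanV; last by rewrite divr_gt0// oppr_gt0.
by rewrite mulNr atanN; field; rewrite gt_eqF.
Qed.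

Let rho_opt0 : rho_opt L a0 a1 0 = 0.
Proof. by rewrite rho_optD D0 u_gt0 Y0 mul0r atan0 mulr0. Qed.

Let rho_opt1 : rho_opt L a0 a1 1 = 1.
Proof.
rewrite rho_opt_psi// /psi.
have -> : D 1 / Y 1 = tan (pi / 2 - L).
  have -> : D 1 = c * v by rewrite /D; ring.
  have -> : Y 1 = S * v by rewrite /Y; ring.
  have -> : pi / 2 - L = - (L - pi / 2) by ring.
  rewrite /tan sinN cosN sinBpihalf cosBpihalf opprK -/c -/S.
  by field; rewrite !gt_eqF.
rewrite tanK; first by field; rewrite gt_eqF.
by rewrite in_itv/=; have p0 := pi_gt0 R; have Lp := L_pi; have L0 := L_gt0; apply/andP; split; lra.
Qed.

Let g s := S * u * v / (L * aopt s).

Let dpsi s : 0 < s -> is_derive s 1 psi (g s).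
Proof.
move=> s0; have Yp := Y_gt0 s0; have Yn : Y s != 0 by rewrite gt_eqF.
have dV : is_derive s 1 (fun r => (Y r)^-1) (- (Y s) ^- 2 *: Y').
  exact: is_deriveV.
have dq := is_deriveM (dD s) dV.
have da := @is_derive1_comp _ atan (D * (fun r => (Y r)^-1)) s _ _
  (is_derive1_atan _) dq.
have dp : is_derive s 1 (cst (pi / 2) - (atan \o (D * (fun r => (Y r)^-1)))) _ :=
  is_deriveB (is_derive_cst (pi / 2) s 1) da.
have := is_deriveZ L^-1 dp.
have -> : L^-1 \*: (cst (pi / 2) - (atan \o (D * (fun r => (Y r)^-1)))) = psi by [].
move=> h; apply: is_derive_eq h _.
rewrite /g -(areal s) aoptE /GRing.scale/= sub0r.
have a_n0 : D s ^+ 2 + Y s ^+ 2 != 0 by rewrite gt_eqF// ltr_pwDr ?sqr_ge0// exprn_gt0.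
have Ln : L != 0 by rewrite gt_eqF.
have n1 : 1 + (D s / Y s) ^+ 2 != 0 by rewrite gt_eqF// ltr_pwDl// sqr_ge0.
by rewrite [X in X ^+ 2](_ : _ = D s / Y s)//; field; rewrite Yn Ln a_n0.
Qed.

Let drho s : 0 < s -> is_derive s 1 (rho_opt L a0 a1) (g s).
Proof.
move=> s0; apply: near_eq_is_derive (dpsi s0).
have : \forall r \near s, r \in `]0, s + 1[%R.
  by apply: near_in_itvoo; rewrite in_itv/= s0 ltrDl ltr01.
by apply: filterS => r; rewrite in_itv/= => /andP[r0 _]; rewrite rho_opt_psi.
Qed.

Let aopt_pos s : 0 <= s -> 0 < aopt s.
Proof.
rewrite le_eqVlt => /predU1P[<-|s0]; rewrite aoptE.
  by rewrite ltr_pwDl ?sqr_ge0// exprn_gt0// D0.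
by rewrite ltr_pwDr ?sqr_ge0// exprn_gt0// Y_gt0.
Qed.

Let cg : {within `[0, 1], continuous g}.
Proof.
apply: continuous_in_subspaceT => s; rewrite inE/= in_itv/= => /andP[s0 _].
apply: cvgM; first exact: cvg_cst.
apply: (@continuousV _ _ (fun r => L * aopt r)).
  by rewrite mulf_neq0// gt_eqF// aopt_pos.
by apply: cvgM; [exact: cvg_cst|exact: caopt].
Qed.

Let crho : {within `[0, 1], continuous (rho_opt L a0 a1)}.
Proof.
apply/continuous_within_itvP => //; split.
- by move=> s; rewrite in_itv/= => /andP[s0 _]; exact: is_derive_continuous (drho s0).
(* At 0 the form [psi] breaks down since [Y 0 = 0]. There [D] is close to [u > 0], so the first
   branch of [rho_opt] applies in a neighbourhood. *)
- apply: cvg_at_right_filter.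
  have Dn : \forall r \near (0 : R), 0 < D r.
    have : D @ (0 : R) --> D 0 by exact: cD.
    by move=> /cvgr_gt; apply; rewrite D0.
  have c0 : {for 0, continuous (fun r => L^-1 * atan (Y r / D r))}.
    apply: cvgM; first exact: cvg_cst.
    apply: (@continuous_comp _ _ _ (fun r => Y r / D r) atan); last exact: continuous_atan.
    apply: cvgM; first exact: cY.
    by apply: (@continuousV _ _ D); [rewrite D0 gt_eqF|exact: cD].
  have e0 : L^-1 * atan (Y 0 / D 0) = rho_opt L a0 a1 0.
    by rewrite rho_opt0 Y0 mul0r atan0 mulr0.
  rewrite -e0; apply: cvg_trans c0; apply: near_eq_cvg.
  apply: filterS Dn => r Dr; transitivity (rho_opt L a0 a1 r) => //.
  by rewrite rho_optD Dr.
- by apply: cvg_at_left_filter; exact: is_derive_continuous (drho ltr01).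
Qed.

Let wrho : {ae mu, forall s, I01 s -> weak_derivative (rho_opt L a0 a1) s = g s}.
Proof.
by apply: C1_weak_derivative_ae => // s; rewrite I01_P => /andP[s0 _]; exact: drho.
Qed.

Lemma rho_opt_admissible : admissible_rho (rho_opt L a0 a1).
Proof.
split => //.
  by apply: (C1_H1 crho cg) => s; rewrite I01_P => /andP[s0 _]; exact: drho.
apply: filterS wrho; first exact: (ae_filter_ringOfSetsType mu).
move=> s + s01 => /(_ s01) ->.
move: s01; rewrite I01_P => /andP[s0 _].
by rewrite divr_ge0 ?mulr_ge0// ?ltW// aopt_pos// ltW.
Qed.

Lemma action_opt : action (L ^+ 2) (rho_opt L a0 a1) aopt
    = (a0 + a1 - 2 * Num.sqrt (a0 * a1) * cos L)%:E.
Proof.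
apply: action_geodesic; first by rewrite addr_gt0.
  by case: rho_opt_admissible.
apply: filterS wrho; first exact: (ae_filter_ringOfSetsType mu).
move=> s + s01 => /(_ s01) ->; rewrite areal /g.
move: s01; rewrite I01_P => /andP[s0 _].
by have := aopt_pos (ltW s0); move: (aopt s) => A A0; field; rewrite !gt_eqF.
Qed.

End Explicit.

(** * Competitors near the apex *)

Section Competitor.
Context {R : realType}.
Local Notation mu := (@lebesgue_measure R).
Local Notation I01 := (`]0, 1[%classic : set R).
Variables (L a0 a1 d : R).
Hypotheses (a0_ge0 : 0 <= a0) (a1_ge0 : 0 <= a1) (d_gt0 : 0 < d) (d_lt1 : d < 1).

Let K := Num.sqrt a0 + Num.sqrt a1.
Let theta := Num.sqrt a0 / K.
(* [s0, s0 + d] contains theta and stays in [0, 1], also when theta is an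
   endpoint. *)
Let s0 := theta * (1 - d).
(* Adding a square keeps the bound a'^2 / (4 a) <= K^2 + w'^2, by
   Cauchy-Schwarz. *)
Let w (s : R) := d * (s * (1 - s)).
Let a (s : R) := K ^+ 2 * (s - theta) ^+ 2 + w s * w s.
Let a' (s : R) := 2 * K ^+ 2 * (s - theta) + 2 * (w s * (d * (1 - 2 * s))).
Let rho := rampat s0 d.

Let K_ge0 : 0 <= K. Proof. by rewrite addr_ge0 ?sqrtr_ge0. Qed.

Let Ktheta : K * theta = Num.sqrt a0.
Proof.
rewrite /theta; have [K0|K0] := eqVneq K 0; last by rewrite mulrCA divff// mulr1.
rewrite K0 mul0r; apply/eqP; rewrite eq_le sqrtr_ge0/=.
by rewrite -K0 lerDl sqrtr_ge0.
Qed.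

Let s0_ge0 : 0 <= s0.
Proof.
have /andP[t0 t1] := apex_theta01 a0 a1.
by rewrite mulr_ge0// subr_ge0 ltW.
Qed.

Let s0_le : s0 + d <= 1.
Proof.
have /andP[t0 t1] := apex_theta01 a0 a1; rewrite -/K -/theta in t0 t1.
by rewrite /s0; have d0 := d_gt0; have d1 := d_lt1; nra.
Qed.

Let s0_theta s : s0 <= s -> s <= s0 + d -> (s - theta) ^+ 2 <= d ^+ 2.
Proof.
have /andP[t0 t1] := apex_theta01 a0 a1; rewrite -/K -/theta in t0 t1.
rewrite /s0 => h1 h2; have d0 := d_gt0; have d1 := d_lt1.
have h3 : - d <= s - theta by nra.
have h4 : s - theta <= d by nra.
nra.
Qed.

Let da (s : R) : is_derive s 1 a (a' s).
Proof.
have d1 : is_derive s 1 (fun r => K ^+ 2 * (r - theta) ^+ 2) (2 * K ^+ 2 * (s - theta)).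
  apply: (@is_derive_quadratic _ _ _ _ (K ^+ 2)) => h.
  rewrite (_ : _ - _ - _ = K ^+ 2 * h ^+ 2); last by ring.
  by rewrite ger0_norm// mulr_ge0 ?sqr_ge0.
have d2 : is_derive s 1 w (d * (1 - 2 * s)).
  apply: (@is_derive_quadratic _ _ _ _ d) => h.
  rewrite (_ : _ - _ - _ = - (d * h ^+ 2)); last by rewrite /w; ring.
  by rewrite normrN ger0_norm// mulr_ge0 ?sqr_ge0// ltW.
have := is_deriveD d1 (is_deriveM d2 d2).
have -> : (fun r => K ^+ 2 * (r - theta) ^+ 2) + w * w = a by [].
by move=> h; apply: is_derive_eq h _; rewrite /a' /GRing.scale/=; ring.
Qed.

Let ca' : continuous a'.
Proof.
have cid c : continuous (fun s : R => s - c).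
  by move=> x; apply: cvgB; [exact: cvg_id|exact: cvg_cst].
have c1 : continuous (fun s : R => 1 - s).
  by move=> x; apply: cvgB; [exact: cvg_cst|exact: cvg_id].
move=> x; apply: cvgD; first by apply: cvgM; [exact: cvg_cst|exact: cid].
apply: cvgM; first exact: cvg_cst.
apply: cvgM; apply: cvgM; try exact: cvg_cst.
  by apply: cvgM; [exact: cvg_id|exact: c1].
apply: cvgB; first exact: cvg_cst.
by apply: cvgM; [exact: cvg_cst|exact: cvg_id].
Qed.

Let a_gt0 s : I01 s -> 0 < a s.
Proof.
rewrite I01_P => /andP[s_0 s_1]; rewrite /a ltr_wpDl//.
  by rewrite mulr_ge0// sqr_ge0.
by rewrite mulr_gt0// /w !mulr_gt0// subr_gt0.
Qed.

Let H1a : H1 a.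
Proof.
apply: (@C1_H1 _ a a') => //; apply: continuous_subspaceT => //.
by move=> x; exact: is_derive_continuous (da x).
Qed.

Lemma competitor_a : admissible_a a0 a1 a.
Proof.
split => //.
  have -> : a 0 = (K * theta) ^+ 2 by rewrite /a /w; ring.
  by rewrite Ktheta sqr_sqrtr.
have -> : a 1 = (K - K * theta) ^+ 2 by rewrite /a /w; ring.
by rewrite Ktheta /K addrAC subrr add0r sqr_sqrtr.
Qed.

Let H1rho : H1 rho.
Proof.
apply: (@C1_H1 _ rho (hatat s0 d)).
- apply: continuous_subspaceT => x; exact: is_derive_continuous (is_derive_rampat _ _ _).
- by apply: continuous_subspaceT; exact: continuous_hatat.
- by move=> x _; exact: is_derive_rampat.
Qed.

Let wrho : {ae mu, forall s, I01 s -> weak_derivative rho s = hatat s0 d s}.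
Proof.
apply: C1_weak_derivative_ae; last by move=> x _; exact: is_derive_rampat.
by apply: continuous_subspaceT; exact: continuous_hatat.
Qed.

Let wa : {ae mu, forall s, I01 s -> weak_derivative a s = a' s}.
Proof. by apply: C1_weak_derivative_ae => //; exact: continuous_subspaceT. Qed.

Lemma competitor_rho : admissible_rho rho.
Proof.
split => //.
- exact: rampat_le.
- exact: rampat_ge.
apply: filterS wrho; first exact: (ae_filter_ringOfSetsType mu).
by move=> s + s01 => /(_ s01) ->; have /andP[] := hatat_bound s0 s d_gt0.
Qed.

(** The angular term lives on [[s0, s0 + d]], within [d] of [theta], where [a] is at most
    [(K ^+ 2 + 1) * d ^+ 2]. One factor [hatat] is bounded by [2 / d], the other is kept and
    integrates to 1, so the jump of rho costs O(d). *)
Let density_bound s : I01 s ->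
  L ^+ 2 * hatat s0 d s ^+ 2 * a s + a' s ^+ 2 / (4 * a s)
  <= K ^+ 2 + d ^+ 2 + 2 * L ^+ 2 * d * (K ^+ 2 + 1) * hatat s0 d s.
Proof.
move=> s01; have ap := a_gt0 s01; rewrite addrC lerD//.
  rewrite ler_pdivrMr ?mulr_gt0//.
  have s1 : (1 - 2 * s) ^+ 2 <= 1.
    by move: s01; rewrite I01_P => /andP[? ?]; nra.
  have -> : a' s ^+ 2 = 4 * (K * (K * (s - theta)) + w s * (d * (1 - 2 * s))) ^+ 2.
    by rewrite /a'; ring.
  have -> : (K ^+ 2 + d ^+ 2) * (4 * a s) =
    4 * ((K ^+ 2 + d ^+ 2) * ((K * (s - theta)) ^+ 2 + w s ^+ 2)) by rewrite /a; ring.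
  rewrite ler_pM2l//.
  set x := K * (s - theta); set y := w s; set z := d * (1 - 2 * s).
  have z2 : z ^+ 2 <= d ^+ 2 by rewrite exprMn ler_piMr// sqr_ge0.
  have : (K * x + y * z) ^+ 2 <= (K ^+ 2 + z ^+ 2) * (x ^+ 2 + y ^+ 2).
    rewrite -subr_ge0 (_ : _ - _ = (K * y - x * z) ^+ 2) ?sqr_ge0//; ring.
  move=> /le_trans; apply; rewrite ler_wpM2r ?addr_ge0 ?sqr_ge0//.
  by rewrite lerD2l.
have /andP[h0 h2] := hatat_bound s0 s d_gt0.
have [ss|ss] := leP s s0; first by rewrite hatat_le// expr0n/= !(mulr0, mul0r).
have [sd|sd] := leP (s0 + d) s; first by rewrite hatat_ge// expr0n/= !(mulr0, mul0r).
have th := s0_theta (ltW ss) (ltW sd).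
have w2 : w s * w s <= d ^+ 2.
  rewrite -expr2 /w exprMn ler_piMr ?sqr_ge0//.
  move: s01; rewrite I01_P => /andP[x0 x1].
  have : 0 <= s * (1 - s) by nra.
  have : s * (1 - s) <= 1 by nra.
  by move: (s * (1 - s)) => q ? ?; nra.
have ab : a s <= (K ^+ 2 + 1) * d ^+ 2.
  rewrite mulrDl mul1r lerD// ler_wpM2l ?sqr_ge0//.
set H := hatat s0 d s in h0 h2 *.
have -> : L ^+ 2 * H ^+ 2 * a s = L ^+ 2 * (H * (H * a s)) by ring.
have -> : 2 * L ^+ 2 * d * (K ^+ 2 + 1) * H =
   L ^+ 2 * (H * (2 / d * ((K ^+ 2 + 1) * d ^+ 2))) by field; rewrite gt_eqF.
rewrite ler_wpM2l ?sqr_ge0// ler_wpM2l// ler_pM// ltW//.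
Qed.

Lemma competitor_action :
  (action (L ^+ 2) rho a <= (K ^+ 2 + d ^+ 2 + 2 * L ^+ 2 * d * (K ^+ 2 + 1))%:E)%E.
Proof.
pose B := 2 * L ^+ 2 * d * (K ^+ 2 + 1).
have B0 : 0 <= B.
  have K1 : 0 <= K ^+ 2 + 1 by rewrite addr_ge0// sqr_ge0.
  have d0 := ltW d_gt0; have L2 := sqr_ge0 L.
  by apply: mulr_ge0 => //; apply: mulr_ge0 => //; apply: mulr_ge0.
have ch x y : {within `[x, y], continuous hatat s0 d}.
  by apply: continuous_subspaceT; exact: continuous_hatat.
have hat2 : L2 (hatat s0 d) by exact: within_L2.
have ihat := L2_integrable hat2.
have ihat1 : \int[mu]_(s in I01) hatat s0 d s = 1.
  rewrite -Rintegral_I01_cc//.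
  have [|||||_ ->] := @Rintegral_support _ `[0, 1]%classic `[s0, s0 + d]%classic (hatat s0 d).
  - by [].
  - by [].
  - by apply: subset_itv; rewrite bnd_simp.
  - move=> x _ /=; rewrite in_itv/= => /negP; rewrite negb_and -!ltNge => /orP[xs|xs].
      by rewrite hatat_le// ltW.
    by rewrite hatat_ge// ltW.
  - exact: integrable_cont.
  exact: integral_hatat.
have ib : mu.-integrable I01 (EFin \o (fun s => K ^+ 2 + d ^+ 2 + B * hatat s0 d s)).
  by apply: integrable_I01D; [exact: integrable_I01_cst|exact: integrable_I01Z].
have -> : K ^+ 2 + d ^+ 2 + B = \int[mu]_(s in I01) (K ^+ 2 + d ^+ 2 + B * hatat s0 d s).
  have i1 := @integrable_I01_cst R (K ^+ 2 + d ^+ 2).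
  have i2 := integrable_I01Z B ihat.
  by rewrite RintegralD// Rintegral_I01_cst RintegralZl// ihat1 mulr1.
rewrite /Rintegral fineK; last first.
  by have := @integrable_fin_num _ _ _ mu I01 _ _ ib; apply.
have mb : measurable_fun I01 (fun s => (K ^+ 2 + d ^+ 2 + B * hatat s0 d s)%:E).
  exact: measurable_int ib.
apply: ae_ge0_le_integral => //.
- move=> s s01; rewrite lee_fin cone_action_density//.
  by rewrite addr_ge0 ?sqr_ge0.
- exact: action_density_measurable.
- move=> s _; have /andP[h0 _] := hatat_bound s0 s d_gt0.
  by rewrite lee_fin addr_ge0 ?addr_ge0 ?sqr_ge0// mulr_ge0.
have := wa; apply: filterS2 wrho; first exact: (ae_filter_ringOfSetsType mu).
move=> s wr wA s01; rewrite wr// wA// lee_fin.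
exact: density_bound.
Qed.

End Competitor.

(** * The value of the infimum *)

Section Value.
Context {R : realType}.
Variables (L a0 a1 : R).
Hypotheses (L_ge0 : 0 <= L) (a0_ge0 : 0 <= a0) (a1_ge0 : 0 <= a1).

Lemma J_le rho a : admissible_rho rho -> admissible_a a0 a1 a ->
  (J (L ^+ 2) a0 a1 <= action (L ^+ 2) rho a)%E.
Proof. by move=> arho aa; apply: ereal_inf_lbound; exists rho, a. Qed.

Lemma J_ge : ((a0 + a1 - 2 * Num.sqrt (a0 * a1) * cos_pi L)%:E <= J (L ^+ 2) a0 a1)%E.
Proof.
apply: le_ereal_inf_tmp => _ [rho [a [arho aa ->]]].
exact: action_ge_cos_pi.
Qed.

(** Passing through the apex is possible for every [L], at a cost independent of [L]. For [L < pi]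
    this is sharp when [a0 * a1 = 0], which is the case that [rho_opt] cannot settle. *)
Lemma J_le_apex : (J (L ^+ 2) a0 a1 <= (a0 + a1 + 2 * Num.sqrt (a0 * a1))%:E)%E.
Proof.
have -> : a0 + a1 + 2 * Num.sqrt (a0 * a1) = (Num.sqrt a0 + Num.sqrt a1) ^+ 2.
  by rewrite sqrtrM// -{1}[a0]sqr_sqrtr// -{1}[a1]sqr_sqrtr//; ring.
set K := Num.sqrt a0 + _; pose C := 1 + 2 * L ^+ 2 * (K ^+ 2 + 1).
have C0 : 0 < C.
  have K1 : 0 <= K ^+ 2 + 1 by rewrite addr_ge0// sqr_ge0.
  have L2 := sqr_ge0 L.
  by rewrite ltr_wpDr//; apply: mulr_ge0 => //; apply: mulr_ge0.
apply/lee_addgt0Pr => e e0.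
(* The excess in [competitor_action] is at most [d * C], as d^2 <= d for [d < 1]. *)
pose d := Num.min (2^-1) (e / C).
have d0 : 0 < d by rewrite lt_min invr_gt0 ltr0n divr_gt0.
have dh : d <= 2^-1 by rewrite ge_min lexx.
have d1 : d < 1 by rewrite (le_lt_trans dh)// invf_lt1// ltr1n.
have dC : d * C <= e by rewrite -ler_pdivlMr// ge_min lexx orbT.
apply: (le_trans (J_le (competitor_rho a0 a1 d0 d1) (competitor_a a0_ge0 a1_ge0 d0))).
apply: (le_trans (competitor_action L a0 a1 d0 d1)).
rewrite -EFinD lee_fin -/K -addrA lerD2l (le_trans _ dC)//.
rewrite /C [leRHS]mulrDr mulr1 lerD//; first by rewrite expr2 ler_piMr// ltW.
by rewrite le_eqVlt; apply/orP; left; apply/eqP; ring.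
Qed.

Lemma J_value : J (L ^+ 2) a0 a1 = (a0 + a1 - 2 * Num.sqrt (a0 * a1) * cos_pi L)%:E.
Proof.
apply/eqP; rewrite eq_le J_ge andbT.
have [a01|a01] := eqVneq (a0 * a1) 0.
  by have := J_le_apex; rewrite a01 sqrtr0 !mulr0 mul0r subr0 addr0.
rewrite /cos_pi; case: ltP => [Lpi|_]; last first.
  by have := J_le_apex; rewrite mulrN1 opprK.
have := a01; rewrite mulf_eq0 negb_or => /andP[a0n a1n].
have a0p : 0 < a0 by rewrite lt_neqAle eq_sym a0n.
have a1p : 0 < a1 by rewrite lt_neqAle eq_sym a1n.
have a_pos : 0 < a0 + a1 by rewrite addr_gt0.
have aa := a_opt_admissible L_ge0 Lpi a0_ge0 a1_ge0 a_pos.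
have [L0|L0] := eqVneq L 0; last first.
  have Lp : 0 < L by rewrite lt_neqAle eq_sym L0.
  have arho : admissible_rho (rho_opt L a0 a1) by exact: rho_opt_admissible.
  by have := J_le arho aa; rewrite action_opt.
(* For [L = 0] the convention that 0 has inverse 0 makes [rho_opt] identically zero, hence not
   admissible. Any admissible function serves instead, here the ramp with [d = 1/2]. *)
have h0 : (0 : R) < 2^-1 by rewrite invr_gt0 ltr0n.
have h1 : (2^-1 : R) < 1 by rewrite invf_lt1// ltr1n.
have arho := competitor_rho a0 a1 h0 h1.
by have := J_le arho aa; rewrite action_opt_L0//; case: arho.
Qed.

End Value.

Theorem theorem3p1 (R : realType) (L a0 a1 : R)
    (hL : 0 <= L) (ha0 : 0 <= a0) (ha1 : 0 <= a1) :
  [/\ (* the value of the infimum *)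
      J (L ^+ 2) a0 a1
        = (a0 + a1 - 2 * Num.sqrt (a0 * a1) * cos_pi L)%:E,
      (* for L < pi it is attained by the explicit pair *)
      0 < L -> L < pi -> 0 < a0 -> 0 < a1 ->
        minimizer (L ^+ 2) a0 a1 (rho_opt L a0 a1) (a_opt L a0 a1),
      (* in all cases with L < pi the explicit pair realizes the value, even
         when a0 or a1 vanishes and it is not admissible *)
      L < pi ->
        action (L ^+ 2) (rho_opt L a0 a1) (a_opt L a0 a1) = J (L ^+ 2) a0 a1,
      (* for L = 0 the formula for rho is void, and every rho is optimal *)
      L = 0 -> 0 < a0 + a1 -> forall rho : R -> R, admissible_rho rho ->
        minimizer (L ^+ 2) a0 a1 rho (a_opt L a0 a1)
    & (* for L >= pi, convergence of all minimizing sequences *)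
      pi <= L -> exists c theta : R,
        [/\ 0 <= c, 0 <= theta <= 1
          & forall rho a : nat -> R -> R,
              minimizing_sequence (L ^+ 2) a0 a1 rho a ->
              H1_cvg a (fun s => c * (s - theta) ^+ 2) /\
              (0 < a0 + a1 ->
               cvg_to_dirac (fun n => weak_derivative (rho n)) theta)]].
Proof.
have JE := J_value hL ha0 ha1.
have JE' : L < pi -> J (L ^+ 2) a0 a1 = (a0 + a1 - 2 * Num.sqrt (a0 * a1) * cos L)%:E.
  by move=> Lpi; rewrite JE /cos_pi Lpi.
split => //.
- move=> L0 Lpi a00 a10; split; first exact: rho_opt_admissible.
    by apply: a_opt_admissible => //; exact: addr_gt0.
  by rewrite JE'// action_opt.
- move=> Lpi; rewrite JE'//.
  have [a01|a01] := eqVneq (a0 * a1) 0.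
    have [s0|s0] := eqVneq (a0 + a1) 0.
      move/eqP: s0; rewrite paddr_eq0// => /andP[/eqP a00 /eqP a10].
      by rewrite action_opt_zero// a00 a10 mul0r sqrtr0 mulr0 mul0r subr0 addr0.
    by rewrite action_opt_degenerate// lt_neqAle eq_sym s0 addr_ge0.
  have := a01; rewrite mulf_eq0 negb_or => /andP[a0n a1n].
  have a0p : 0 < a0 by rewrite lt_neqAle eq_sym a0n.
  have a1p : 0 < a1 by rewrite lt_neqAle eq_sym a1n.
  have [L0|L0] := eqVneq L 0; last by rewrite action_opt// lt_neqAle eq_sym L0.
  (* At [L = 0] the angular term has weight zero, so [rho_opt] may be exchanged for a ramp that is
     readily seen to be in H^1. *)
  have -> : action (L ^+ 2) (rho_opt L a0 a1) (a_opt L a0 a1)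
      = action (L ^+ 2) (rampat 0 1) (a_opt L a0 a1).
    by rewrite /action L0 expr0n/=; apply: eq_integral => s _; rewrite !mul0r.
  apply: action_opt_L0 => //; first exact: addr_gt0.
  have h0 : (0 : R) < 2^-1 by rewrite invr_gt0 ltr0n.
  have h1 : (2^-1 : R) < 1 by rewrite invf_lt1// ltr1n.
  apply: (@C1_H1 _ _ (hatat 0 1)).
  + by apply: continuous_subspaceT => x; exact: is_derive_continuous (is_derive_rampat _ _ _).
  + by apply: continuous_subspaceT; exact: continuous_hatat.
  + by move=> x _; exact: is_derive_rampat.
- move=> L0 a_pos rho arho; have Lpi : L < pi by rewrite L0 pi_gt0.
  split => //; first exact: a_opt_admissible.
  by rewrite JE'// action_opt_L0//; case: arho.
- move=> piL; have JEpi : J (L ^+ 2) a0 a1 = (a0 + a1 + 2 * Num.sqrt (a0 * a1))%:E.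
    by rewrite JE /cos_pi ltNge piL/= mulrN1 opprK.
  (* The squared speed of the segment and the time at which it meets the apex; for [a0 = a1 = 0]
     both are 0. *)
  exists ((Num.sqrt a0 + Num.sqrt a1) ^+ 2), (Num.sqrt a0 / (Num.sqrt a0 + Num.sqrt a1)).
  split; [exact: sqr_ge0|exact: apex_theta01|].
  move=> rho a minim; split; first exact: apex_H1_cvg piL ha0 ha1 JEpi minim.
  exact: apex_cvg_to_dirac piL ha0 ha1 JEpi minim.
Qed.
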